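(* Let $\dot{H}$ be a totally disconnected graph of order $s$, and let $\dot{\mathscr{B}}_m$ be the maximal signed bipartite graph with $\dot{H}$ as a star complement for an eigenvalue $\mu$, where $s=\mu^2+1\geq 3$. (1) If $\mu^2\in 2\mathbb{Z}^{+}\setminus 4\mathbb{Z}^{+}$, then $\dot{\mathscr{B}}_m\cong^s \big(K_{2,\mu^2}\cup K_1,\ E(K_{1,\frac{\mu^2}{2}})\big)$. (2) If $\mu^2\in \mathcal{N}(\mathcal{H})$, then $\dot{\mathscr{B}}_m$ is switching isomorphic to the disjoint union of a bipartite signed strongly regular graph with parameters $SRG^s(2\mu^2,\mu^2,0,0,0)$ and an isolated vertex $(K_1,\emptyset)$. (3) If $\mu^2\in \mathcal{N}(\mathcal{C})$, then $\dot{\mathscr{B}}_m$ is switching isomorphic to a bipartite signed strongly regular graph with parameters $SRG^s(2\mu^2+2,\mu^2,0,0,0)$.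
   Context: A signed graph is a pair $(G,\Sigma^-)$ where $G$ is a finite simple graph (the underlying graph) and $\Sigma^-\subseteq E(G)$ is its set of negative edges; its adjacency matrix has entry $1$ for positive edges, $-1$ for negative edges and $0$ otherwise; its eigenvalues are those of this matrix. It is bipartite if $G$ is. The totally disconnected (signed) graph of order $s$ is $(sK_1,\emptyset)$, with $s$ vertices and no edges. If $\mu$ is an eigenvalue of a signed graph $(G,\Sigma^-)$ of multiplicity $k$, a star set for $\mu$ is a set $S\subseteq V(G)$ with $|S|=k$ such that $\mu$ is not an eigenvalue of the induced signed subgraph $(G,\Sigma^-)-S$; then $(G,\Sigma^-)-S$ is called a star complement for $\mu$ in $(G,\Sigma^-)$. ''Maximal'' means: of maximum order among all signed bipartite graphs with $\dot{H}$ as a star complement for $\mu$. Two signed graphs are isomorphic if their adjacency matrices satisfy $A_2=P^{-1}A_1P$ for a permutation matrix $P$, and switching equivalent if $A_2=D^{-1}A_1D$ for a diagonal matrix $D$ with diagonal entries $\pm1$. They are switching isomorphic, written $\cong^s$, if one is isomorphic to a signed graph switching equivalent to the other. In $(K_{2,\mu^2}\cup K_1,E(K_{1,\mu^2/2}))$ the negative edges form a star $K_{1,\mu^2/2}$ centred at a vertex of the part of size $2$ of $K_{2,\mu^2}$. $\mathcal{N}(\mathcal{H})$ is the set of natural numbers $m$ having at least one of the following forms (each known to be the order of a Hadamard matrix): (i) $m=2^a$, $a\geq 1$; (ii) $m=2^a(r^h+1)$, $a\geq 2$, $h\geq 1$, $r$ a prime; (iii) $m=2^a r(r+1)$, $a\geq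 2$, $r\equiv 3 \pmod 4$ a prime; (iv) $m=r+1$, $r\equiv 3\pmod 4$ a prime power; (v) $m=2(r+1)$, $r\equiv 1\pmod 4$ a prime power. $\mathcal{N}(\mathcal{C})$ is the set of odd prime powers, where by the paper's convention $1$ is allowed as an odd prime power (for $m\in\mathcal{N}(\mathcal{C})$ a Conference matrix of order $m+1$ is known to exist). The sign of a walk is the product of the signs of its edges; $w_2(u,v)$ is the number of positive walks of length $2$ between $u$ and $v$ minus the number of negative ones. A signed graph on $n$ vertices is strongly regular with parameters $SRG^s(n,r,a,b,c)$ if its underlying graph is regular of degree $r$, it is neither homogeneous complete (complete with all edges of the same sign) nor totally disconnected, and there are integers $a,b,c$ such that $w_2(u,v)=a$ for every positive edge $uv$, $w_2(u,v)=b$ for every negative edge $uv$, and $w_2(u,v)=c$ for all distinct non-adjacent $u,v$. The superscript $s$ in $SRG^s$ stands for ''signed'' and is unrelated to the order $s$. *)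

(* Defs.v *)
From HB Require Import structures.
From mathcomp Require Import all_boot all_order all_algebra.
From mathcomp Require Import reals.

Set Implicit Arguments.
Unset Strict Implicit.
Unset Printing Implicit Defensive.

Import Order.TTheory GRing.Theory Num.Theory.
Local Open Scope ring_scope.

Record sgraph (T : finType) := SGraph {
  edge : rel T;
  neg : rel T;
  edge_sym : symmetric edge;
  edge_irr : irreflexive edge;
  neg_sym : symmetric neg;
  neg_sub : subrel neg edge
}.

Section SignedGraphs.
Variable T : finType.
Implicit Types G : sgraph T.

(* Only meaningful when x and y are adjacent. *)
Definition edge_sign G (x y : T) : int := if neg G x y then -1 else 1.

(* The vertices are numbered by the canonical enumeration of T. *)
Definition adjmx (R : nzRingType) G : 'M[R]_#|T| :=
  \matrix_(i, j) if edge G (enum_val i) (enum_val j)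
                 then (edge_sign G (enum_val i) (enum_val j))%:~R else 0.

Definition bipartite G : Prop :=
  exists c : T -> bool, forall x y, edge G x y -> c x != c y.

Definition totally_disconnected G : Prop := forall x y, ~~ edge G x y.

Definition homogeneous_complete G : Prop :=
  (forall x y, x != y -> edge G x y) /\
  ((forall x y, edge G x y -> ~~ neg G x y) \/
   (forall x y, edge G x y -> neg G x y)).

(* A walk of length 2 from u to v is given by its middle vertex. *)
Definition walks2 G (u v : T) (e : int) : {set T} :=
  [set x | [&& edge G u x, edge G x v & edge_sign G u x * edge_sign G x v == e]].

Definition w2 G (u v : T) : int :=
  #|walks2 G u v 1|%:Z - #|walks2 G u v (-1)|%:Z.

Definition srg G (n r : nat) (a b c : int) : Prop :=
  [/\ #|T| = n,
      forall u, #|[set v | edge G u v]| = r,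
      ~ homogeneous_complete G /\ ~ totally_disconnected G
    & [/\ forall u v, edge G u v -> ~~ neg G u v -> w2 G u v = a,
          forall u v, neg G u v -> w2 G u v = b
        & forall u v, u != v -> ~~ edge G u v -> w2 G u v = c]].

Definition switching_equivalent G1 G2 : Prop :=
  exists2 d : 'rV[int]_#|T|,
    forall i, d 0 i = 1 \/ d 0 i = -1 &
    adjmx int G2 = invmx (diag_mx d) *m adjmx int G1 *m diag_mx d.

Section Induced.
Variables (G : sgraph T) (A : {set T}).
Let U := {x : T | x \in A}.
Let e : rel U := fun x y => edge G (val x) (val y).
Let n : rel U := fun x y => neg G (val x) (val y).
Fact induced_edge_sym : symmetric e. Proof. by move=> x y; apply: edge_sym. Qed.
Fact induced_edge_irr : irreflexive e. Proof. by move=> x; apply: edge_irr. Qed.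
Fact induced_neg_sym : symmetric n. Proof. by move=> x y; apply: neg_sym. Qed.
Fact induced_neg_sub : subrel n e. Proof. by move=> x y; apply: neg_sub. Qed.
Definition induced : sgraph U :=
  SGraph induced_edge_sym induced_edge_irr induced_neg_sym induced_neg_sub.
End Induced.

Definition del_vertices G (S : {set T}) := induced G (~: S).

End SignedGraphs.

(* castmx only identifies 'M_#|T1| with 'M_#|T2| along the equality of orders. *)
Definition isomorphic (T1 T2 : finType) (G1 : sgraph T1) (G2 : sgraph T2) : Prop :=
  exists (eqT : #|T1| = #|T2|) (P : 'M[int]_#|T2|),
    is_perm_mx P /\
    adjmx int G2 = invmx P *m castmx (eqT, eqT) (adjmx int G1) *m P.

Definition switching_isomorphic (T1 T2 : finType)
    (G1 : sgraph T1) (G2 : sgraph T2) : Prop :=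
  exists2 G : sgraph T2, switching_equivalent G2 G & isomorphic G1 G.

Section Edgeless.
Variable T : finType.
Let e : rel T := fun _ _ => false.
Fact edgeless_sym : symmetric e. Proof. by []. Qed.
Fact edgeless_irr : irreflexive e. Proof. by []. Qed.
Fact edgeless_sub : subrel e e. Proof. by []. Qed.
Definition edgeless : sgraph T :=
  SGraph edgeless_sym edgeless_irr edgeless_sym edgeless_sub.
End Edgeless.

Definition sK1 (s : nat) : sgraph 'I_s := edgeless 'I_s.

Section DisjointUnion.
Variables (T1 T2 : finType) (G1 : sgraph T1) (G2 : sgraph T2).
Let U := (T1 + T2)%type.
Let lift_rel (r1 : rel T1) (r2 : rel T2) : rel U := fun x y =>
  match x, y with
  | inl x1, inl y1 => r1 x1 y1
  | inr x2, inr y2 => r2 x2 y2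
  | _, _ => false
  end.
Let e := lift_rel (edge G1) (edge G2).
Let n := lift_rel (neg G1) (neg G2).
Fact disj_union_edge_sym : symmetric e.
Proof. by move=> [x|x] [y|y] //=; apply: edge_sym. Qed.
Fact disj_union_edge_irr : irreflexive e.
Proof. by move=> [x|x] //=; apply: edge_irr. Qed.
Fact disj_union_neg_sym : symmetric n.
Proof. by move=> [x|x] [y|y] //=; apply: neg_sym. Qed.
Fact disj_union_neg_sub : subrel n e.
Proof. by move=> [x|x] [y|y] //=; apply: neg_sub. Qed.
Definition disj_union : sgraph U :=
  SGraph disj_union_edge_sym disj_union_edge_irr
         disj_union_neg_sym disj_union_neg_sub.
End DisjointUnion.

(* K_{p,q} in which the edge joining i and j is negative iff N i j. *)
Section SignedCompleteBipartite.
Variables (p q : nat) (N : 'I_p -> 'I_q -> bool).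
Let U := ('I_p + 'I_q)%type.
Let cross (r : 'I_p -> 'I_q -> bool) : rel U := fun x y =>
  match x, y with
  | inl i, inr j | inr j, inl i => r i j
  | _, _ => false
  end.
Let e := cross (fun _ _ => true).
Let n := cross N.
Fact signedK_edge_sym : symmetric e. Proof. by move=> [x|x] [y|y]. Qed.
Fact signedK_edge_irr : irreflexive e. Proof. by move=> [x|x]. Qed.
Fact signedK_neg_sym : symmetric n. Proof. by move=> [x|x] [y|y]. Qed.
Fact signedK_neg_sub : subrel n e. Proof. by move=> [x|x] [y|y]. Qed.
Definition signedK : sgraph U :=
  SGraph signedK_edge_sym signedK_edge_irr signedK_neg_sym signedK_neg_sub.
End SignedCompleteBipartite.

(* K_{2,m} whose negative edges form a star K_{1,m/2} centred in the part of
   size 2. *)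
Definition K2_half_star (m : nat) : sgraph ('I_2 + 'I_m)%type :=
  signedK (fun (i : 'I_2) (j : 'I_m) => (i == ord0) && (j < m %/ 2)%N).

Section StarComplements.
Variable R : realType.
Implicit Types mu : R.

(* Adjacency matrices are symmetric, so the multiplicity of an eigenvalue is
   the dimension of its eigenspace. *)
Definition star_set (T : finType) (G : sgraph T) mu (S : {set T}) : Prop :=
  [/\ eigenvalue (adjmx R G) mu,
      #|S| = \rank (eigenspace (adjmx R G) mu)
    & ~~ eigenvalue (adjmx R (del_vertices G S)) mu].

Definition star_complement (U T : finType) (H : sgraph U) mu (G : sgraph T) : Prop :=
  exists2 S : {set T}, star_set G mu S & isomorphic (del_vertices G S) H.

Definition maximal_bipartite (U T : finType) (H : sgraph U) mu (B : sgraph T) : Prop :=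
  [/\ bipartite B, star_complement H mu B
    & forall (W : finType) (G : sgraph W),
        bipartite G -> star_complement H mu G -> (#|W| <= #|T|)%N].

End StarComplements.

Definition prime_power (q : nat) : Prop :=
  exists p k : nat, [/\ prime p, (0 < k)%N & q = (p ^ k)%N].

(* Orders of Hadamard matrices given by the classical constructions. *)
Definition NH (m : nat) : Prop :=
  [\/ exists2 a : nat, (1 <= a)%N & m = (2 ^ a)%N,
      exists a h r : nat,
        [/\ (2 <= a)%N, (1 <= h)%N, prime r & m = (2 ^ a * (r ^ h + 1))%N],
      exists a r : nat,
        [/\ (2 <= a)%N, prime r, r = 3 %[mod 4] & m = (2 ^ a * r * (r + 1))%N]
    | (exists r : nat, [/\ prime_power r, r = 3 %[mod 4] & m = (r + 1)%N]) \/
      (exists r : nat, [/\ prime_power r, r = 1 %[mod 4] & m = (2 * (r + 1))%N])].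

(* Odd prime powers, 1 included: for such m a conference matrix of order m + 1
   is known. *)
Definition NC (m : nat) : Prop := m = 1%N \/ odd m /\ prime_power m.

(* Main.v *)
Require Import Defs.
From mathcomp Require Import all_boot all_order all_algebra.
From mathcomp Require Import all_fingroup all_field.
From mathcomp Require Import reals.
From mathcomp Require Import zify ring.

Set Implicit Arguments.
Unset Strict Implicit.
Unset Printing Implicit Defensive.

Import Order.TTheory GRing.Theory Num.Theory.
Local Open Scope ring_scope.

(** Let S be a star set for mu whose complement C is edgeless, |C| = m + 1,
    m = mu ^ 2. The restriction of the eigenspace of mu to S is bijective onto
    the functions on S, and on C an eigenvector is determined by its values on
    S. Evaluating the eigenvector that restricts to the indicator of x in S
    gives, with a the signed adjacency matrix, for x, y in S,
      mu ^ 2 [x = y] = mu a_xy + sum_(z in C) a_xz a_zy      (star_set_gram),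
    and conversely this identity makes S a star set (star_set_intro). So each
    x in S is adjacent to all of C but one vertex; as m > 1, any two vertices
    of S have a common neighbour in C, hence in a bipartite graph S is
    independent and the rows (a_xz)_(z in C) are pairwise orthogonal.
    Thus the bipartite signed graphs in question are exactly the signed
    bipartite graphs of matrices M with m + 1 columns, entries in {0, 1, -1},
    and rows of squared norm m that are pairwise orthogonal
    (bipartite_star_complement_structure, bigraph_star_complement), and the
    maximal one has the largest possible number of rows.

    Each row has one zero entry. The inner product of two rows has the parity
    of m if the zeros are in the same column and of m - 1 otherwise, so the
    zeros share a column when m is even and are in distinct columns when m is
    odd (ternary_missing_parity).
    - If m = 2 mod 4, three orthogonal rows of signs of length m do not exist
      (ternary_three_rows) but two do. Switching at the vertices of C turns
      the second row into the constant 1, and the first row then has m / 2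
      entries -1: this is the half star of K_(2,m), plus an isolated vertex.
    - If a Hadamard matrix of order m exists, then m is even and the maximum
      is m rows; deleting the zero column leaves a square matrix.
    - If a conference matrix of order m + 1 exists, the maximum is m + 1 rows
      and M itself is square.
    In the two square cases the columns are orthogonal too, so the adjacency
    matrix of the bipartite graph of the square matrix squares to m, which is
    strong regularity with parameters a = b = c = 0 (srg_square_bigraph).

    The matrices come from classical constructions: Sylvester doubling; Paley
    conference matrices, which give Hadamard matrices of order q + 1 in the
    skew case q = 3 mod 4 and 2 (q + 1) in the symmetric case q = 1 mod 4, and
    also q (q + 1) in the skew case. The orders 2 ^ a (2 ^ h + 1) with a at
    least 2 are obtained from a Golay pair of length 2 ^ (h - 1), which yields
    four cyclic sign sequences of length 2 ^ h + 1 that fit in the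
    Goethals-Seidel array. *)

(** * Orthogonal rows and Hadamard orders *)

(** The rows of h are pairwise orthogonal, with common squared norm w. *)
Definition rows_orthogonal (I J : finType) (w : nat) (h : I -> J -> int) :
    Prop :=
  forall i j, \sum_k h i k * h j k = w%:Z *+ (i == j).

(** A Hadamard matrix of order n exists. Rows and columns are indexed by an
    arbitrary finite type, which suits product and field index sets. *)
Definition hadamard_order (n : nat) : Prop :=
  exists (I : finType) (h : I -> I -> int),
    [/\ #|I| = n, forall i j, h i j ^+ 2 = 1 & rows_orthogonal n h].

Lemma sum_pair (I J : finType) (F : I * J -> int) :
  \sum_p F p = \sum_i \sum_j F (i, j).
Proof. by rewrite pair_bigA; apply: eq_bigr => -[]. Qed.

Lemma big_option (V : nmodType) (I : finType) (G : option I -> V) :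
  \sum_p G p = G None + \sum_i G (Some i).
Proof.
rewrite (bigD1 None) //=; congr (_ + _).
rewrite (reindex_omap Some id) /=; last by case.
by apply: eq_bigl => i; rewrite eqxx.
Qed.

Lemma sum_natb (I : finType) (F : I -> int) i : \sum_k F k *+ (i == k) = F i.
Proof.
rewrite (bigD1 i) //= eqxx big1 ?addr0 // => k /negPf.
by rewrite eq_sym => ->.
Qed.

Lemma hadamard_order1 : hadamard_order 1.
Proof.
exists unit, (fun _ _ => 1); split; first by rewrite card_unit.
  by move=> _ _; rewrite expr1n.
by move=> [] []; rewrite (bigD1 tt) //= big1 // => -[].
Qed.

Lemma hadamard_order_double n : hadamard_order n -> hadamard_order (2 * n).
Proof.
move=> [I [h [cI h1 hh]]].
exists (bool * I)%type, (fun p q => (-1) ^+ (p.1 && q.1) * h p.2 q.2).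
split; first by rewrite card_prod card_bool cI.
  by move=> [b i] [c j]; rewrite exprMn h1 sqrr_sign mulr1.
move=> [b i] [c j].
rewrite sum_pair big_bool /= !andbT !andbF !expr0.
under eq_bigr => k _ do rewrite mulrACA.
under [X in _ + X]eq_bigr => k _ do rewrite !mul1r.
rewrite -mulr_sumr hh xpair_eqE /=.
by case: b; case: c; case: (i == j) => /=; rewrite ?expr0 ?expr1; lia.
Qed.

Lemma hadamard_order_pow2M a n : hadamard_order n -> hadamard_order (2 ^ a * n).
Proof.
move=> hn; elim: a => [|a IH]; first by rewrite expn0 mul1n.
by rewrite expnS -mulnA; apply: hadamard_order_double.
Qed.

(** * The Goethals-Seidel array *)

Section GoethalsSeidel.
Variable Z : finZmodType.
Implicit Types f g : Z -> int.

(** The periodic autocorrelation of f at shift s. *)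
Definition autocorr f (s : Z) : int := \sum_k f k * f (k + s).

Lemma sum_translate (c : Z) (F : Z -> int) : \sum_k F k = \sum_k F (k + c).
Proof. by rewrite (reindex_inj (addIr c)). Qed.

Lemma sum_reflect (c : Z) (F : Z -> int) : \sum_k F k = \sum_k F (c - k).
Proof. by rewrite (reindex_inj (inj_comp (addrI c) oppr_inj)). Qed.

Lemma corr_shift f i j : \sum_k f (k - i) * f (k - j) = autocorr f (i - j).
Proof.
by rewrite (sum_translate i); apply: eq_bigr => k _; rewrite addrK addrA.
Qed.

Lemma corr_plus f i j : \sum_k f (i + k) * f (j + k) = autocorr f (i - j).
Proof.
rewrite (sum_translate (- j)); apply: eq_bigr => k _.
by rewrite mulrC; congr (f _ * f _); rewrite addrCA ?subrr ?addr0.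
Qed.

Lemma corr_minus f i j :
  \sum_k f (- i - k) * f (- j - k) = autocorr f (i - j).
Proof.
rewrite (sum_reflect (- i)); apply: eq_bigr => k _.
congr (f _ * f _); first exact: subKr.
by rewrite opprB opprK addrC addrA.
Qed.

(** In the Goethals-Seidel array, an inner product of two rows of different
    block rows is a sum of four of the following correlations, with signs; the
    next five identities make them cancel in pairs. *)
Lemma cross_shift f g i j :
  \sum_k f (k - i) * g (j + k) = \sum_k g (i + k) * f (k - j).
Proof.
rewrite (sum_translate (i - j)); apply: eq_bigr => k _.
rewrite mulrC; congr (g _ * f _); last by rewrite addrA addrAC addrK.
by rewrite addrCA [j + _]addrCA subrr addr0 addrC.
Qed.

Lemma cross_plus f g i j :
  \sum_k f (i + k) * g (- j - k) = \sum_k g (i + k) * f (- j - k).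
Proof.
rewrite (sum_reflect (- i - j)); apply: eq_bigr => k _.
rewrite mulrC; congr (g _ * f _); last by rewrite !addrA subrr add0r.
by rewrite !opprB opprK addrCA addKr addrC.
Qed.

Lemma cross_same f g i j :
  \sum_k f (i + k) * g (j + k) = \sum_k g (- i - k) * f (- j - k).
Proof.
rewrite (sum_reflect (- i - j)); apply: eq_bigr => k _.
rewrite mulrC; congr (g _ * f _); last by rewrite !addrA subrr add0r.
by rewrite [- i - j]addrC !addrA subrr add0r.
Qed.

Lemma cross_minus f g i j :
  \sum_k f (- i - k) * g (j + k) = \sum_k g (- i - k) * f (j + k).
Proof.
rewrite (sum_reflect (- i - j)); apply: eq_bigr => k _.
rewrite mulrC; congr (g _ * f _); last first.
  by rewrite !opprB opprK addrCA [- i + _]addrC addrK addrC.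
by rewrite [- i - j]addrC !addrA subrr add0r.
Qed.

Lemma cross_mixed f g i j :
  \sum_k f (k - i) * g (- j - k) = \sum_k g (- i - k) * f (k - j).
Proof.
rewrite (sum_translate (i - j)); apply: eq_bigr => k _.
rewrite mulrC; congr (g _ * f _); last by rewrite addrA addrAC addrK.
by rewrite !opprD opprK addrCA [- j + _]addrCA addNr addr0 addrC.
Qed.

(** The 4 x 4 block array, blocks being indexed by pairs of booleans:
      [  A    BR    CR    DR  ]
      [ -BR   A     D'R  -C'R ]
      [ -CR  -D'R   A     B'R ]
      [ -DR   C'R  -B'R   A   ]
    where the blocks A, BR and B'R have entries a (k - i), b (i + k) and
    b (- i - k) at (i, k), and likewise for C and D. *)
Definition goethals_seidel (a b c d : Z -> int)
    (p q : (bool * bool) * Z) : int :=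
  let i := p.2 in let k := q.2 in
  match p.1, q.1 with
  | (false, false), (false, false) => a (k - i)
  | (false, false), (false, true) => b (i + k)
  | (false, false), (true, false) => c (i + k)
  | (false, false), (true, true) => d (i + k)
  | (false, true), (false, false) => - b (i + k)
  | (false, true), (false, true) => a (k - i)
  | (false, true), (true, false) => d (- i - k)
  | (false, true), (true, true) => - c (- i - k)
  | (true, false), (false, false) => - c (i + k)
  | (true, false), (false, true) => - d (- i - k)
  | (true, false), (true, false) => a (k - i)
  | (true, false), (true, true) => b (- i - k)
  | (true, true), (false, false) => - d (i + k)
  | (true, true), (false, true) => c (- i - k)
  | (true, true), (true, false) => - b (- i - k)
  | (true, true), (true, true) => a (k - i)
  end.

Lemma hadamard_order_goethals_seidel (a b c d : Z -> int) :
    (forall k, [/\ a k ^+ 2 = 1, b k ^+ 2 = 1, c k ^+ 2 = 1 & d k ^+ 2 = 1]) ->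
    (forall s, autocorr a s + autocorr b s + autocorr c s + autocorr d s
               = (4 * #|Z|)%:Z *+ (s == 0)) ->
  hadamard_order (4 * #|Z|).
Proof.
move=> h1 hc; exists ((bool * bool) * Z)%type, (goethals_seidel a b c d).
split; first by rewrite !card_prod card_bool.
  move=> [[[] []] i] [[[] []] k]; rewrite /goethals_seidel /= ?sqrrN;
    by case: (h1 (k - i)); case: (h1 (i + k)); case: (h1 (- i - k)).
have sumNl (F G : Z -> int) : \sum_k - F k * G k = - \sum_k F k * G k.
  by rewrite -sumrN; under eq_bigr => k _ do rewrite mulNr.
have sumNr (F G : Z -> int) : \sum_k F k * - G k = - \sum_k F k * G k.
  by rewrite -sumrN; under eq_bigr => k _ do rewrite mulrN.
move=> [u i] [v j]; have := hc (i - j); rewrite subr_eq0 xpair_eqE.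
rewrite sum_pair !(sum_pair, big_bool) /=.
move: u v => [[] []] [[] []]; rewrite /goethals_seidel /=;
  rewrite ?sumNl ?sumNr ?opprK ?(corr_shift, corr_plus, corr_minus) => hs;
  rewrite ?(cross_shift, cross_mixed, cross_same)
    ?(cross_plus c b, cross_plus d b, cross_plus d c)
    ?(cross_minus c b, cross_minus d b, cross_minus d c).
all: by [ring | rewrite -hs; ring].
Qed.
End GoethalsSeidel.

(** * Cyclic Golay pairs *)

Lemma val_sub_inord n (k : 'I_n.+1) g : (g <= n)%N ->
  val (k - inord g) = if (g <= k)%N then (k - g)%N else (n.+1 + k - g)%N.
Proof.
move=> gn; rewrite /= inordK ?ltnS //; have := ltn_ord k; rewrite ltnS => kn.
case: (posnP g) => [->|g0]; first by rewrite subn0 modnn addn0 subn0 modn_small.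
rewrite (@modn_small (n.+1 - g)) ?ltn_subrL ?g0 //.
case: leqP => gk; last by rewrite modn_small; lia.
have ->: (k + (n.+1 - g) = (k - g) + n.+1)%N by lia.
by rewrite modnDr modn_small; lia.
Qed.

Lemma autocorr_translate (Z : finZmodType) (f : Z -> int) c s :
  autocorr (fun k => f (k - c)) s = autocorr f s.
Proof.
rewrite /autocorr (sum_translate c); apply: eq_bigr => k _.
by rewrite addrK addrAC addrK.
Qed.

Lemma autocorr_delta (Z : finZmodType) (s : Z) :
  autocorr (fun k => (k == 0)%:R) s = (s == 0)%:R.
Proof.
rewrite /autocorr (bigD1 0) //= eqxx add0r mul1r big1 ?addr0 // => k /negPf ->.
by rewrite mul0r.
Qed.

(** A Golay pair of length 2 ^ e, placed at the start of a cycle of length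
    n + 1. The doubling step sends (a, b) to a followed by b and a followed by
    -b. It preserves complementarity whatever the cycle length; the bound
    2 ^ e <= n + 1 only keeps the two supports disjoint. *)
Lemma cyclic_golay_pair n e : (2 ^ e <= n.+1)%N ->
  exists a b : 'I_n.+1 -> int,
    [/\ forall k, a k ^+ 2 = (k < 2 ^ e)%N%:R,
        forall k, b k ^+ 2 = (k < 2 ^ e)%N%:R
      & forall s, autocorr a s + autocorr b s = (2 * 2 ^ e)%N%:Z *+ (s == 0)].
Proof.
elim: e => [|e IH] en.
  exists (fun k => (k == 0)%:R), (fun k => (k == 0)%:R).
  have h (k : 'I_n.+1) : ((k == 0)%:R : int) ^+ 2 = (k < 2 ^ 0)%N%:R.
    by rewrite expn0 ltnS leqn0 -val_eqE /=; case: (_ == _);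
      rewrite ?expr1n ?expr0n.
  by split=> // s; rewrite autocorr_delta; case: (s == 0).
have e0 : (0 < 2 ^ e)%N by rewrite expn_gt0.
move: en; rewrite expnS => en.
have [|a [b [ha hb hab]]] := IH; first lia.
pose g : 'I_n.+1 := inord (2 ^ e).
have hk (k : 'I_n.+1) : a k ^+ 2 + b (k - g) ^+ 2 = (k < 2 * 2 ^ e)%N%:R
    /\ a k * b (k - g) = 0.
  have := ha k; have := hb (k - g); rewrite val_sub_inord; last lia.
  have kn := ltn_ord k.
  case: (ltnP k (2 ^ e)) => [kg|gk] Hb Ha.
    have Eb : b (k - g) = 0.
      apply/eqP; rewrite -(sqrf_eq0 (b (k - g))) Hb ltnNge.
      by rewrite (_ : (_ <= _)%N); last lia.
    rewrite Ha Eb mulr0 expr0n addr0; split=> //.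
    by rewrite (_ : (k < _)%N = true) //; lia.
  have Ea : a k = 0 by apply/eqP; rewrite -sqrf_eq0 Ha.
  rewrite Hb Ea mul0r expr0n add0r; split=> //; congr (nat_of_bool _)%:R; lia.
exists (fun k => a k + b (k - g)), (fun k => a k - b (k - g)); split.
- by move=> k; have [<- h] := hk k; rewrite sqrrD h mul0rn addr0.
- by move=> k; have [<- h] := hk k; rewrite sqrrB h mul0rn subr0.
move=> s; transitivity (2 * (autocorr a s + autocorr (fun k => b (k - g)) s)).
  rewrite /autocorr -!big_split /= mulr_sumr.
  by apply: eq_bigr => k _; ring.
by rewrite autocorr_translate hab; case: (s == 0); lia.
Qed.

(** With 2 g = 2 ^ h, the cycle of length 2 g + 1 is covered by the disjoint
    supports of d, the indicator of 0, and of the shifts x and y of a Golay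
    pair of length g. The four sequences d + x + y, d + x - y, d - x + y and
    d - x - y have entries 1 and -1, and their autocorrelations add up to four
    times those of d, x and y. *)
Lemma hadamard_order_4pow2S h : (0 < h)%N -> hadamard_order (4 * (2 ^ h + 1)).
Proof.
case: h => // h _; set n := (2 ^ h.+1)%N; rewrite addn1.
pose g := (2 ^ h)%N; have ng : n = (2 * g)%N by rewrite /n expnS.
have g0 : (0 < g)%N by rewrite expn_gt0.
have [|a [b [ha hb hab]]] := @cyclic_golay_pair n h; first by rewrite -/g; lia.
pose d (k : 'I_n.+1) : int := (k == 0)%:R.
pose x (k : 'I_n.+1) := a (k - inord 1).
pose y (k : 'I_n.+1) := b (k - inord g.+1).
have hk k : [\/ [/\ d k ^+ 2 = 1, x k = 0 & y k = 0],
                [/\ d k = 0, x k ^+ 2 = 1 & y k = 0]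
              | [/\ d k = 0, x k = 0 & y k ^+ 2 = 1]].
  have := ha (k - inord 1); have := hb (k - inord g.+1).
  rewrite !val_sub_inord; try lia.
  rewrite -/(x k) -/(y k) -/g => Hy Hx; have kn := ltn_ord k.
  have z0 (z : int) (c : bool) : z ^+ 2 = c%:R -> ~~ c -> z = 0.
    by move=> hz /negPf cF; apply/eqP; rewrite -sqrf_eq0 hz cF.
  have z1 (z : int) (c : bool) : z ^+ 2 = c%:R -> c -> z ^+ 2 = 1.
    by move=> -> ->.
  have d0 : d k = (nat_of_ord k == 0%N)%:R by [].
  have [k0|kg|kg] : [\/ k = 0%N :> nat, (0 < k <= g)%N | (g < k)%N].
    case: (posnP k) => [k0|k0]; first exact: Or31.
    by case: (leqP k g) => kg; [apply: Or32; apply/andP | apply: Or33].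
  - apply: Or31; rewrite d0 k0; split=> //; [apply: z0 Hx _ | apply: z0 Hy _];
      case: ifP => ?; lia.
  - apply: Or32; rewrite d0 (_ : (_ == _) = false); last by apply/negP; lia.
    by split=> //; [apply: z1 Hx _ | apply: z0 Hy _]; case: ifP => ?; lia.
  - apply: Or33; rewrite d0 (_ : (_ == _) = false); last by apply/negP; lia.
    by split=> //; [apply: z0 Hx _ | apply: z1 Hy _]; case: ifP => ?; lia.
rewrite -[in X in hadamard_order X](card_ord n.+1).
apply: (@hadamard_order_goethals_seidel _
  (fun k => d k + x k + y k) (fun k => d k + x k - y k)
  (fun k => d k - x k + y k) (fun k => d k - x k - y k)) => [k|s].
  by case: (hk k) => -[]; split; nia.
transitivity (4 * (autocorr d s + (autocorr x s + autocorr y s))).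
  rewrite /autocorr -!big_split /= mulr_sumr.
  by apply: eq_bigr => k _; ring.
rewrite /x /y !autocorr_translate hab autocorr_delta card_ord.
by case: (s == 0); rewrite -/g; lia.
Qed.

(** * The quadratic character and Paley conference matrices *)

(** The quadratic character of a finite field of odd order, by Euler's
    criterion. *)
Definition quad_char (F : finFieldType) (x : F) : int :=
  if x == 0 then 0 else if x ^+ #|F|.-1./2 == 1 then 1 else -1.

Section QuadraticCharacter.
Variables (F : finFieldType) (q : nat).
Hypotheses (card_F : #|F| = q) (q_odd : odd q).

Local Notation chi := (@quad_char F).

Let q_gt2 : (2 < q)%N.
Proof.
by have := finNzRing_gt1 F; rewrite card_F; case: (q) q_odd => [|[|[|n]]].
Qed.

Let half_pred_card : (q.-1./2).*2 = q.-1.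
Proof. by have := q_odd; lia. Qed.

Let euler_sq (x : F) : x != 0 -> x ^+ q.-1./2 == 1 \/ x ^+ q.-1./2 == -1.
Proof.
move=> x0; apply/orP; rewrite -eqf_sqr expr1n -exprM muln2 half_pred_card.
apply/eqP/(mulfI x0); rewrite mulr1 -exprS prednK -?card_F ?expf_card // card_F.
exact: ltnW (ltnW q_gt2).
Qed.

Lemma quad_char0 : chi 0 = 0. Proof. by rewrite /quad_char eqxx. Qed.

Lemma quad_char1 : chi 1 = 1.
Proof. by rewrite /quad_char oner_eq0 expr1n eqxx. Qed.

Lemma quad_char_sq x : chi x ^+ 2 = (x != 0)%:R.
Proof. by rewrite /quad_char; case: eqP => // _; case: eqP. Qed.

Lemma quad_charM x y : chi (x * y) = chi x * chi y.
Proof.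
rewrite /quad_char ?card_F mulf_eq0 exprMn.
case: (eqVneq x 0) => [|x0] /=; first by rewrite mul0r.
case: (eqVneq y 0) => [|y0] /=; first by rewrite mulr0.
case: (eqVneq (x ^+ _) 1) => [->|hx]; first by rewrite !mul1r.
case: (eqVneq (y ^+ _) 1) => [->|hy].
  by rewrite mulr1 (negPf hx).
have [/eqP|/eqP ->] := euler_sq x0; first by move/eqP: hx.
have [/eqP|/eqP ->] := euler_sq y0; first by move/eqP: hy.
by rewrite mulrNN mulr1 eqxx.
Qed.

Let card_nonzero : #|predC1 (0 : F)| = q.-1.
Proof. by rewrite cardC1 card_F. Qed.

(** Otherwise 'X^((q - 1) / 2) - 1 would have q - 1 roots. *)
Lemma quad_nonresidue : exists2 g : F, g != 0 & g ^+ q.-1./2 != 1.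
Proof.
have e0 : (0 < q.-1./2)%N by have := q_gt2; lia.
have [all1|] := boolP (all (q.-1./2).-unity_root (enum (predC1 (0 : F)))).
  have := max_unity_roots e0 all1 (enum_uniq _).
  by rewrite -cardE card_nonzero => ?; exfalso; have := q_gt2; lia.
by case/allPn=> g; rewrite mem_enum inE unity_rootE; exists g.
Qed.

Lemma opp1_neq1 : -1 != 1 :> F.
Proof.
have [g g0 g1] := quad_nonresidue.
by have [h|/eqP <- //] := euler_sq g0; rewrite h in g1.
Qed.

Lemma quad_charN1 : chi (-1) = if (q %% 4 == 1)%N then 1 else -1.
Proof.
rewrite /quad_char ?card_F oppr_eq0 oner_eq0 -signr_odd.
have -> : (q %% 4 == 1)%N = ~~ odd q.-1./2 by have := q_odd; lia.
by case: (odd _) => /=; rewrite ?eqxx // expr1 (negPf opp1_neq1).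
Qed.

Lemma quad_charN x : chi (- x) = chi (-1) * chi x.
Proof. by rewrite -[- x]mulN1r quad_charM. Qed.

Lemma sum_quad_char : \sum_x chi x = 0.
Proof.
have [g g0 g1] := quad_nonresidue.
have cg : chi g = -1 by rewrite /quad_char ?card_F (negPf g0) (negPf g1).
have : \sum_x chi x = - \sum_x chi x.
  rewrite {1}(reindex_inj (mulfI g0)) -sumrN; apply: eq_bigr => x _.
  by rewrite quad_charM cg mulN1r.
by lia.
Qed.

(** For k and s nonzero, chi k * chi (k + s) = chi (1 + s / k), and k to
    1 + s / k is injective on F: with 1 / 0 = 0 it sends 0 to 1. *)
Lemma autocorr_quad_char s : autocorr chi s = q%:Z *+ (s == 0) - 1.
Proof.
rewrite /autocorr; case: eqVneq => [->|s0].
  under eq_bigr => k _ do rewrite addr0 -expr2 quad_char_sq.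
  rewrite (bigD1 0) //= eqxx add0r (eq_bigr (fun _ => 1)) => [|k ->] //.
  rewrite sumr_const card_nonzero natz mulr1n -subn1.
  exact/esym/subzn/ltnW/ltnW.
transitivity (\sum_k (chi (1 + s * k^-1) - (k == 0)%:R)).
  apply: eq_bigr => k _; case: eqVneq => [->|k0].
    by rewrite invr0 mulr0 addr0 quad_char1 quad_char0 mul0r subrr.
  have -> : k + s = k * (1 + s * k^-1).
    by rewrite mulrDr mulr1 mulrCA divff ?mulr1.
  by rewrite quad_charM mulrA -expr2 quad_char_sq k0 mul1r subr0.
have inj_mob : injective (fun k => 1 + s * k^-1).
  by move=> x y /addrI /(mulfI s0) /invr_inj.
rewrite sumrB -(reindex_inj inj_mob (P := xpredT) (F := chi)) sum_quad_char.
rewrite (bigD1 0) //= eqxx big1 ?addr0 // => k /negPf -> //.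
Qed.
End QuadraticCharacter.

(** U is a conference matrix that is symmetric (eps = 1) or skew (eps = -1). *)
Definition conference (I : finType) (eps : int) (U : I -> I -> int) : Prop :=
  [/\ forall i, U i i = 0,
      forall i j, i != j -> U i j ^+ 2 = 1,
      forall i j, U j i = eps * U i j
    & rows_orthogonal #|I|.-1 U].

(** The value of the quadratic character of a field of order q at -1. *)
Definition paley_eps (q : nat) : int := if (q %% 4 == 1)%N then 1 else -1.

(** The matrix (chi (j - i)) bordered by one row and one column, indexed by
    None. *)
Definition paley_conference (F : finFieldType) (x y : option F) : int :=
  match x, y with
  | None, None => 0
  | None, Some _ => 1
  | Some _, None => paley_eps #|F|
  | Some i, Some j => quad_char (j - i)
  end.

Lemma paley_conferenceP (F : finFieldType) q : #|F| = q -> odd q ->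
  conference (paley_eps q) (@paley_conference F).
Proof.
move=> cF oF; have e2 : paley_eps q ^+ 2 = 1 by rewrite /paley_eps; case: ifP.
have sumT (i : F) : \sum_j quad_char (j - i) = 0.
  rewrite (sum_translate i) -[RHS](sum_quad_char cF oF).
  by apply: eq_bigr => j _; rewrite addrK.
split.
- by case=> [i|] //=; rewrite subrr quad_char0.
- case=> [i|] [j|] //= ij; rewrite ?cF ?e2 ?expr1n // quad_char_sq subr_eq0.
  by rewrite eq_sym (_ : i != j).
- case=> [i|] [j|] //=; rewrite ?cF ?mulr0 ?mulr1 -?expr2 ?e2 //.
  by rewrite -opprB (quad_charN cF oF) (quad_charN1 cF oF).
rewrite card_option cF /= => -[i|] [j|]; rewrite big_option /= ?cF.
- rewrite corr_shift (autocorr_quad_char cF oF) -expr2 e2 subr_eq0.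
  by rewrite (inj_eq Some_inj) addrCA subrr addr0.
- by rewrite mulr0 add0r -mulr_suml sumT mul0r.
- by rewrite mul0r add0r; under eq_bigr => k _ do rewrite mul1r; exact: sumT.
- by rewrite mul0r add0r sumr_const mulr1n mulr1 cF natz.
Qed.

Lemma conference_prime_power q : odd q -> prime_power q ->
  exists (I : finType) (U : I -> I -> int),
    #|I| = q.+1 /\ conference (paley_eps q) U.
Proof.
move=> oq [p [k [pr_p k0 qE]]]; have [F _ cF] := PrimePowerField pr_p k0.
exists (option F), (@paley_conference F); rewrite card_option cF -qE; split=> //.
by apply: paley_conferenceP; rewrite // cF qE.
Qed.

Section FromConference.
Variables (I : finType) (U : I -> I -> int) (n : nat).
Hypothesis cardI : #|I| = n.+1.

(** The matrix 1 + U. *)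
Lemma hadamard_order_skew_conference :
  conference (-1) U -> hadamard_order n.+1.
Proof.
case=> U0 U1 Us; rewrite cardI /= => Uo.
exists I, (fun i j => (i == j)%:R + U i j); split=> //.
  move=> i j; case: eqVneq => [->|ij]; first by rewrite U0 addr0.
  by rewrite add0r U1.
move=> i j.
transitivity (\sum_k ((i == j)%:R *+ (j == k) + U i k *+ (j == k)
   + U j k *+ (i == k) + U i k * U j k)).
  apply: eq_bigr => k _; case: (eqVneq j k) => [<-|jk] /=; last first.
    by case: (i == k); rewrite /= ?mulr0n ?mulr1n; ring.
  by case: (i == j); rewrite /= ?mulr0n ?mulr1n; ring.
rewrite !big_split /= !sum_natb Uo Us.
by case: (i == j); rewrite /= ?mulr0n ?mulr1n; lia.
Qed.

(** The matrix of 2 x 2 blocks: U_ij times (1, 1; 1, -1) off the diagonal, and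
    (1, -1; -1, -1) on the diagonal. *)
Lemma hadamard_order_sym_conference :
  conference 1 U -> hadamard_order (2 * n.+1).
Proof.
case=> U0 U1 Us; rewrite cardI /= => Uo.
pose s (b c : bool) : int := (-1) ^+ (b && c).
pose t (b c : bool) : int := (-1) ^+ (b || c).
exists (bool * I)%type,
  (fun p q => s p.1 q.1 * U p.2 q.2 + t p.1 q.1 * (p.2 == q.2)%:R).
split; first by rewrite card_prod card_bool cardI.
  move=> [b i] [c j] /=; case: eqVneq => [->|ij].
    by rewrite U0 mulr0 add0r mulr1 sqrr_sign.
  by rewrite mulr0 addr0 exprMn U1 // sqrr_sign.
move=> [b i] [c j]; rewrite sum_pair big_bool xpair_eqE /=.
have Q (x y z w : int) : \sum_k (x * U i k + y * (i == k)%:R) *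
       (z * U j k + w * (j == k)%:R) =
    x * z * (n%:Z *+ (i == j)) + (x * w + y * z) * U i j + y * w * (i == j)%:R.
  transitivity (\sum_k (x * z * (U i k * U j k) + x * w * U i k *+ (j == k)
     + y * z * U j k *+ (i == k) + y * w * (i == j)%:R *+ (j == k))).
    apply: eq_bigr => k _; case: (eqVneq j k) => [<-|jk] /=; last first.
      by case: (i == k); rewrite /= ?mulr0n ?mulr1n; ring.
    by case: (i == j); rewrite /= ?mulr0n ?mulr1n; ring.
  rewrite !big_split /= !sum_natb -mulr_sumr Uo (Us i j).
  by ring.
rewrite !Q /s /t.
by case: b; case: c; case: (i == j); rewrite /= ?expr0 ?expr1 ?mulr0n ?mulr1n; lia.
Qed.

End FromConference.

(** With U the skew Paley conference matrix of order q + 1, J the all-one matrix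
    of order q and C = 1 + (chi (y - x)), the matrix 1 (x) J + U (x) C works:
    C has constant row sums 1 and C C' = (q + 1) - J, and the cross terms
    (U + U') (x) J vanish. *)
Lemma hadamard_order_mul_succ (F : finFieldType) q :
  #|F| = q -> (q %% 4 = 3)%N -> hadamard_order (q * (q + 1)).
Proof.
move=> cF F3; have oF : odd q by move: F3; lia.
have e1 : paley_eps q = -1 by rewrite /paley_eps F3.
have [U0 U1 Us Uo] := paley_conferenceP cF oF.
rewrite e1 card_option cF /= in Us Uo.
set U := @paley_conference F in U0 U1 Us Uo.
pose C (x y : F) : int := (x == y)%:R + quad_char (y - x).
have Co x y : \sum_z C x z * C y z = (q + 1)%:Z *+ (x == y) - 1.
  transitivity (\sum_z ((x == y)%:R *+ (y == z) + quad_char (z - x) *+ (y == z)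
    + quad_char (z - y) *+ (x == z) + quad_char (z - x) * quad_char (z - y))).
    apply: eq_bigr => k _; rewrite /C; case: (eqVneq y k) => [<-|jk] /=; last first.
      by case: (x == k); rewrite /= ?mulr0n ?mulr1n; ring.
    by case: (x == y); rewrite /= ?mulr0n ?mulr1n; ring.
  rewrite !big_split /= !sum_natb corr_shift (autocorr_quad_char cF oF) subr_eq0.
  rewrite -(opprB x y) (quad_charN cF oF) (quad_charN1 cF oF) F3 /=.
  move: (quad_char (x - y)) => c.
  by case: (x == y); rewrite /= ?mulr0n ?mulr1n; lia.
have Cs x : \sum_z C x z = 1.
  rewrite big_split /= (eq_bigr (fun z => 1 *+ (x == z))) // sum_natb.
  rewrite (sum_translate x) (eq_bigr (@quad_char F)) => [|z _]; last first.
    by rewrite addrK.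
  by rewrite (sum_quad_char cF oF) addr0.
exists (option F * F)%type, (fun p r => (p.1 == r.1)%:R + U p.1 r.1 * C p.2 r.2).
split; first by rewrite card_prod card_option cF addn1 mulnC.
  move=> [i x] [j y] /=; case: (eqVneq i j) => [->|ij].
    by rewrite U0 mul0r addr0.
  rewrite add0r exprMn U1 // mul1r /C; case: (eqVneq x y) => [->|xy].
    by rewrite subrr quad_char0 addr0.
  by rewrite add0r quad_char_sq subr_eq0 eq_sym xy.
move=> [i x] [j y]; rewrite sum_pair xpair_eqE /=.
transitivity (\sum_k (q%:Z * (i == j)%:R *+ (j == k) + U i k *+ (j == k)
    + U j k *+ (i == k)
    + U i k * U j k * ((q + 1)%:Z *+ (x == y) - 1))).
  apply: eq_bigr => k _; rewrite -Co mulr_sumr.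
  transitivity (\sum_z ((i == k)%:R * (j == k)%:R
      + (j == k)%:R * U i k * C x z
      + (i == k)%:R * U j k * C y z + U i k * U j k * (C x z * C y z))).
    by apply: eq_bigr => z _; ring.
  rewrite !big_split /= -!mulr_sumr !Cs sumr_const cF.
  congr (_ + _); case: (eqVneq j k) => [<-|jk] /=; last first.
    by case: (i == k); rewrite /= ?mulr0n ?mulr1n; ring.
  by case: (i == j); rewrite /= ?mulr0n ?mulr1n; ring.
rewrite !big_split /= !sum_natb -mulr_suml Uo Us.
by case: (i == j); case: (x == y); rewrite /= ?mulr0n ?mulr1n; lia.
Qed.

Lemma odd_mod4 q : odd q -> (q %% 4 = 1)%N \/ (q %% 4 = 3)%N.
Proof. lia. Qed.

Lemma NH_hadamard_order m : NH m -> hadamard_order m.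
Proof.
have skew r : prime_power r -> (r %% 4 = 3)%N -> hadamard_order (r + 1).
  move=> pr r3; have [|I [U [cI]]] := @conference_prime_power r _ pr; first lia.
  by rewrite /paley_eps r3 addn1 => cU; exact: hadamard_order_skew_conference cU.
have symm r : prime_power r -> (r %% 4 = 1)%N -> hadamard_order (2 * (r + 1)).
  move=> pr r1; have [|I [U [cI]]] := @conference_prime_power r _ pr; first lia.
  by rewrite /paley_eps r1 addn1 => cU; exact: hadamard_order_sym_conference cU.
case=> [[a a1 ->]|[a [h [r [a2 h1 pr ->]]]]|[a [r [a2 pr r3 ->]]]|].
- rewrite -[X in hadamard_order X]muln1.
  exact/hadamard_order_pow2M/hadamard_order1.
- have [r2|r_odd] := even_prime pr.
    have -> : a = (a - 2 + 2)%N by lia.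
    rewrite expnD -mulnA r2; apply: hadamard_order_pow2M.
    exact: hadamard_order_4pow2S.
  have pph : prime_power (r ^ h) by exists r, h.
  have : odd (r ^ h) by rewrite oddX r_odd orbT.
  case/odd_mod4 => rh.
    have -> : a = (a - 1 + 1)%N by lia.
    rewrite expnD -mulnA; apply: hadamard_order_pow2M.
    exact: symm.
  by apply: hadamard_order_pow2M; apply: skew.
- rewrite -mulnA; apply: hadamard_order_pow2M.
  have [F _ cF] := PrimePowerField pr (ltn0Sn 0); rewrite expn1 in cF.
  exact: hadamard_order_mul_succ cF r3.
- by case=> -[r [pr rm ->]]; [apply: skew | apply: symm].
Qed.

(** * Switching isomorphism through bijections *)

(** The entry of the adjacency matrix at a pair of vertices. *)
Definition signed_adj (T : finType) (G : sgraph T) (x y : T) : int :=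
  if edge G x y then edge_sign G x y else 0.

Lemma signed_adj_sym (T : finType) (G : sgraph T) x y :
  signed_adj G x y = signed_adj G y x.
Proof. by rewrite /signed_adj /edge_sign edge_sym neg_sym. Qed.

Lemma signed_adj_sq (T : finType) (G : sgraph T) x y :
  signed_adj G x y ^+ 2 = (edge G x y)%:R.
Proof.
by rewrite /signed_adj /edge_sign; case: (edge G x y); case: (neg G x y).
Qed.

Lemma signed_adj_nedge (T : finType) (G : sgraph T) x y :
  ~~ edge G x y -> signed_adj G x y = 0.
Proof. by rewrite /signed_adj => /negPf ->. Qed.

Lemma adjmxE (T : finType) (R : nzRingType) (G : sgraph T) i j :
  adjmx R G i j = (signed_adj G (enum_val i) (enum_val j))%:~R.
Proof. by rewrite mxE /signed_adj; case: (edge G _ _). Qed.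

Lemma sum_enum_val (T : finType) (V : nmodType) (F : T -> V) :
  \sum_(i < #|T|) F (enum_val i) = \sum_x F x.
Proof.
rewrite [RHS](reindex (@enum_val T T)) //.
by apply: onW_bij; exact: enum_val_bij.
Qed.

Lemma adjmx_edgeless (T : finType) (R : nzRingType) (G : sgraph T) :
  totally_disconnected G -> adjmx R G = 0.
Proof.
by move=> h; apply/matrixP => i j; rewrite adjmxE signed_adj_nedge // mxE.
Qed.

(** The signed graph that makes g a full morphism to G1. *)
Section Pullback.
Variables (T1 T2 : finType) (G1 : sgraph T1) (g : T2 -> T1).
Let e : rel T2 := fun x y => edge G1 (g x) (g y).
Let n : rel T2 := fun x y => neg G1 (g x) (g y).
Fact pullback_edge_sym : symmetric e. Proof. by move=> x y; apply: edge_sym. Qed.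
Fact pullback_edge_irr : irreflexive e. Proof. by move=> x; apply: edge_irr. Qed.
Fact pullback_neg_sym : symmetric n. Proof. by move=> x y; apply: neg_sym. Qed.
Fact pullback_neg_sub : subrel n e. Proof. by move=> x y; apply: neg_sub. Qed.
Definition pullback : sgraph T2 :=
  SGraph pullback_edge_sym pullback_edge_irr pullback_neg_sym pullback_neg_sub.
End Pullback.

Lemma isomorphic_bij (T1 T2 : finType) (G1 : sgraph T1) (G2 : sgraph T2)
    (g : T2 -> T1) :
    bijective g ->
    (forall x y, signed_adj G2 x y = signed_adj G1 (g x) (g y)) ->
  isomorphic G1 G2.
Proof.
move=> bg hg; have eqT : #|T1| = #|T2| by rewrite (bij_eq_card bg).
pose s_fun (i : 'I_#|T2|) := cast_ord eqT (enum_rank (g (enum_val i))).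
have s_inj : injective s_fun.
  by move=> i j /cast_ord_inj /enum_rank_inj /(bij_inj bg) /enum_val_inj.
pose s := perm s_inj; exists eqT, (perm_mx s^-1); split.
  by apply/is_perm_mxP; exists (s^-1)%g.
rewrite -mulmxA; apply: canRL (mulKmx _) _; first exact: unitmx_perm.
have hs k : cast_ord (esym eqT) (s k) = enum_rank (g (enum_val k)).
  by rewrite permE cast_ordK.
rewrite -row_permE -col_permE.
apply/matrixP => i j; rewrite [LHS]mxE [RHS]mxE castmxE /= !adjmxE hg hs.
by rewrite -[i in RHS](permKV s) hs !enum_rankK.
Qed.

Lemma isomorphic_edgeless (T : finType) (G : sgraph T) s :
  isomorphic G (sK1 s) <-> #|T| = s /\ totally_disconnected G.
Proof.
split=> [[eqT [P [/is_perm_mxP[p ->] E]]]|[cT tG]].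
  split=> [|x y]; first by rewrite eqT card_ord.
  have sK10 : adjmx int (sK1 s) = 0 by apply: adjmx_edgeless.
  have uP : perm_mx p \in (@unitmx int #|'I_s|) by exact: unitmx_perm.
  have C0 : castmx (eqT, eqT) (adjmx int G) = 0.
    rewrite -[LHS](mulKVmx uP) -[X in _ *m X](mulmxK uP) -E sK10.
    by rewrite mul0mx mulmx0.
  apply: contraT => /negPn exy.
  have := congr1 (fun M : 'M[int]_#|'I_s| =>
    M (cast_ord eqT (enum_rank x)) (cast_ord eqT (enum_rank y)) ^+ 2) C0.
  by rewrite castmxE /= !cast_ordK adjmxE intz signed_adj_sq !enum_rankK exy mxE.
apply: (@isomorphic_bij _ _ _ _ (fun i => enum_val (cast_ord (esym cT) i))).
  exists (fun x => cast_ord cT (enum_rank x)) => i.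
    by rewrite enum_valK cast_ordKV.
  by rewrite cast_ordK enum_rankK.
by move=> x y; rewrite !signed_adj_nedge.
Qed.

Lemma switching_isomorphic_bij (T1 T2 : finType) (G1 : sgraph T1)
    (G2 : sgraph T2) (g : T2 -> T1) (d : T2 -> int) :
    bijective g -> (forall x, d x ^+ 2 = 1) ->
    (forall x y, signed_adj G2 x y = d x * d y * signed_adj G1 (g x) (g y)) ->
  switching_isomorphic G1 G2.
Proof.
move=> bg d2 hg; exists (pullback G1 g); last exact: isomorphic_bij bg _.
have hd x : d x = 1 \/ d x = -1.
  by have /eqP := d2 x; rewrite sqrf_eq1 => /orP[] /eqP; [left | right].
pose D : 'rV[int]_#|T2| := \row_i d (enum_val i).
exists D => [i|]; first by rewrite mxE.
have D2 : diag_mx D *m diag_mx D = 1%:M.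
  by apply/matrixP => i j; rewrite mul_diag_mx !mxE mulrnAr -expr2 d2.
have uD : diag_mx D \in unitmx by have /mulmx1_unit[] := D2.
rewrite -mulmxA; apply: canRL (mulKmx uD) _.
apply/matrixP => i j; rewrite mul_diag_mx mul_mx_diag [LHS]mxE [RHS]mxE.
rewrite !adjmxE !intz hg ![D _ _]mxE mulrAC -[LHS]mulr1 -(d2 (enum_val j)).
by rewrite /signed_adj /edge_sign /=; ring.
Qed.

Lemma sum_pick (V : pzRingType) (I : finType) (F : I -> V) i :
  \sum_k F k * (k == i)%:R = F i.
Proof.
rewrite (bigD1 i) //= eqxx mulr1 big1 ?addr0 // => k /negPf ->.
by rewrite mulr0.
Qed.

(** * Star sets with an edgeless complement *)

Section StarSet.
Variables (R : realType) (mu : R) (T : finType) (G : sgraph T) (S : {set T}).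
Hypothesis mu0 : mu != 0.
Hypothesis coS_edgeless : forall x y, x \notin S -> y \notin S -> ~~ edge G x y.
Local Notation a x y := ((signed_adj G x y)%:~R : R).
Local Notation E := (eigenspace (adjmx R G) mu).

(** A function on the vertices as a row vector. *)
Definition row_of (f : T -> R) : 'rV[R]_#|T| := \row_i f (enum_val i).

(** The matrix of the restriction of vectors to the coordinates in S. *)
Definition restriction : 'M[R]_(#|T|, #|S|) :=
  \matrix_(i, j) (enum_val i == enum_val j)%:R.

Lemma row_ofK (v : 'rV[R]_#|T|) : row_of (fun x => v 0 (enum_rank x)) = v.
Proof. by apply/rowP => i; rewrite mxE enum_valK. Qed.

Lemma row_of_restriction f j : (row_of f *m restriction) 0 j = f (enum_val j).
Proof.
rewrite mxE; transitivity (\sum_x f x * (x == enum_val j)%:R); last exact: sum_pick.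
by rewrite -[RHS]sum_enum_val; apply: eq_bigr => i _; rewrite !mxE.
Qed.

Lemma row_of_eigen f :
  (row_of f <= E)%MS <-> forall y, \sum_x f x * a x y = mu * f y.
Proof.
have Ey j : (row_of f *m adjmx R G) 0 j = \sum_x f x * a x (enum_val j).
  rewrite mxE -[RHS]sum_enum_val; apply: eq_bigr => i _.
  by rewrite adjmxE mxE.
split=> [/eigenspaceP h y|h].
  have /rowP/(_ (enum_rank y)) := h.
  by rewrite Ey !mxE enum_rankK.
by apply/eigenspaceP/rowP => j; rewrite Ey h !mxE.
Qed.

Lemma eigen_coS f y : y \notin S -> \sum_x f x * a x y = mu * f y ->
  f y = mu^-1 * \sum_(x in S) f x * a x y.
Proof.
move=> yS h; apply: (mulfI mu0); rewrite mulVKf // -h.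
rewrite (bigID (mem S)) /= [X in _ + X]big1 ?addr0 // => x xS.
by rewrite signed_adj_nedge ?mulr0 ?coS_edgeless.
Qed.

(** Restriction to S is injective on the eigenspace, as an eigenvector that
    vanishes on S vanishes on the complement by eigen_coS. *)
Lemma rank_restriction : \rank (E *m restriction) = \rank E.
Proof.
apply/mxrank_injP/eqP/row_matrixP => i.
set v := row i _; have : (v <= E :&: kermx restriction)%MS by exact: row_sub.
rewrite row0 sub_capmx -(row_ofK v); set f := fun x => _.
case/andP=> /row_of_eigen hE /sub_kermxP hK.
have fS x : x \in S -> f x = 0.
  move=> xS; have /rowP/(_ (enum_rank_in xS x)) := hK.
  by rewrite row_of_restriction mxE enum_rankK_in.
apply/rowP => j; rewrite !mxE.
have [/fS //|] := boolP (enum_val j \in S).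
move=> jS; rewrite (eigen_coS jS (hE _)) big1 ?mulr0 // => x xS.
by rewrite fS ?mul0r.
Qed.

(** Here |S| is the dimension of the eigenspace, so by rank_restriction some
    eigenvector f restricts to the indicator of x on S; the identity is its
    eigenvalue equation at y. *)
Lemma star_set_gram (x y : T) : star_set G mu S -> x \in S -> y \in S ->
  mu ^+ 2 * (x == y)%:R = mu * a x y + \sum_(z | z \notin S) a x z * a z y.
Proof.
case=> _ cS _ xS yS.
have full : row_full (E *m restriction) by rewrite /row_full rank_restriction cS.
pose j := enum_rank_in xS x.
have /submxP[D hD] := submx_full (delta_mx 0 j : 'rV[R]_#|S|) full.
pose v := D *m E; have vE : (v <= E)%MS by exact: submxMl.
rewrite mulmxA -/v in hD.
move: vE hD; rewrite -(row_ofK v); set f := fun x => _ => /row_of_eigen hE hD.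
have fS u : u \in S -> f u = (x == u)%:R.
  move=> uS; have /rowP/(_ (enum_rank_in xS u)) := hD.
  rewrite row_of_restriction mxE eqxx /= enum_rankK_in // => <-.
  rewrite /j -(inj_eq enum_val_inj) !enum_rankK_in //.
  by rewrite eq_sym.
have fC z : z \notin S -> f z = mu^-1 * a x z.
  move=> zS; rewrite (eigen_coS zS (hE z)) (bigD1 x) //= fS // eqxx mul1r.
  rewrite big1 ?addr0 // => u /andP[uS ux].
  by rewrite fS // eq_sym (negPf ux) mul0r.
have := hE y; rewrite (fS y yS) => h; rewrite expr2 -mulrA -h.
rewrite (bigID (mem S)) /= mulrDr; congr (_ + _).
  rewrite (bigD1 x) //= fS // eqxx mul1r big1 ?addr0 // => u /andP[uS ux].
  by rewrite fS // eq_sym (negPf ux) mul0r.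
rewrite mulr_sumr; apply: eq_bigr => z zS.
by rewrite fC // !mulrA divff // mul1r.
Qed.

Lemma star_set_intro : S != set0 ->
    (forall x y, x \in S -> y \in S ->
      mu ^+ 2 * (x == y)%:R = mu * a x y + \sum_(z | z \notin S) a x z * a z y) ->
  star_set G mu S.
Proof.
move=> S0 hS.
(* f u is the eigenvector that restricts to the indicator of u on S. *)
pose f u x : R := if x \in S then (u == x)%:R else mu^-1 * a u x.
have fE u : u \in S -> (row_of (f u) <= E)%MS.
  move=> uS; apply/row_of_eigen => y.
  have sumS : \sum_(x in S) f u x * a x y = a u y.
    rewrite (bigD1 u) //= {1}/f uS eqxx mul1r big1 ?addr0 // => x /andP[xS xu].
    by rewrite /f xS eq_sym (negPf xu) mul0r.
  rewrite (bigID (mem S)) /= sumS {2}/f; case: ifP => yS.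
    apply: (mulfI mu0); rewrite mulrA -expr2 hS // mulrDr; congr (_ + _).
    rewrite mulr_sumr; apply: eq_bigr => z zS.
    by rewrite /f (negPf zS) !mulrA divff // mul1r.
  rewrite mulVKf // big1 ?addr0 // => z zS.
  by rewrite signed_adj_nedge ?mulr0 ?coS_edgeless ?yS.
pose W : 'M[R]_(#|S|, #|T|) := \matrix_i row_of (f (enum_val i)).
have WE : (W <= E)%MS.
  by apply/row_subP => i; rewrite rowK; apply/fE/enum_valP.
have WP : W *m restriction = 1%:M.
  apply/row_matrixP => i; rewrite row_mul rowK; apply/rowP => j.
  rewrite row_of_restriction /f enum_valP !mxE.
  by rewrite (inj_eq enum_val_inj).
have rE : \rank E = #|S|.
  apply/eqP; rewrite eqn_leq -{1}rank_restriction rank_leq_col /=.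
  rewrite -[leqLHS](mxrank1 R) -WP (leq_trans (mxrankM_maxl _ _)) //.
  exact: mxrankS.
split=> //; first by rewrite /eigenvalue -mxrank_eq0 rE cards_eq0.
rewrite adjmx_edgeless => [|x y].
  rewrite negbK; apply/eqP/row_matrixP => i; rewrite row0.
  have /eigenspaceP :=
    row_sub i (eigenspace (0 : 'M[R]_#|{: {x : T | x \in ~: S}}|) mu).
  by rewrite mulmx0 => /esym/eqP; rewrite scaler_eq0 (negPf mu0) => /eqP.
by apply: coS_edgeless; have := valP x; have := valP y; rewrite !inE.
Qed.
End StarSet.

(** * Signed bipartite graphs of ternary matrices *)

Definition ternary (I J : finType) (M : I -> J -> int) : Prop :=
  forall i j, M i j \in [:: 0; 1; -1].

(** The signed bipartite graph whose biadjacency matrix is M, when the entries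
    of M are 0, 1 and -1. *)
Section SignedBigraph.
Variables (I J : finType) (M : I -> J -> int).
Let U := (I + J)%type.
Let lift (r : I -> J -> bool) : rel U := fun x y =>
  match x, y with
  | inl i, inr j | inr j, inl i => r i j
  | _, _ => false
  end.
Let e := lift (fun i j => M i j != 0).
Let n := lift (fun i j => M i j < 0).
Fact signed_bigraph_edge_sym : symmetric e. Proof. by move=> [x|x] [y|y]. Qed.
Fact signed_bigraph_edge_irr : irreflexive e. Proof. by move=> [x|x]. Qed.
Fact signed_bigraph_neg_sym : symmetric n. Proof. by move=> [x|x] [y|y]. Qed.
Fact signed_bigraph_neg_sub : subrel n e.
Proof. by move=> [x|x] [y|y] //=; apply: ltr0_neq0. Qed.
Definition signed_bigraph : sgraph U :=
  SGraph signed_bigraph_edge_sym signed_bigraph_edge_irr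
         signed_bigraph_neg_sym signed_bigraph_neg_sub.

Definition bigraph_entry (x y : U) : int :=
  match x, y with
  | inl i, inr j | inr j, inl i => M i j
  | _, _ => 0
  end.

Lemma signed_adj_bigraph : ternary M ->
  forall x y, signed_adj signed_bigraph x y = bigraph_entry x y.
Proof.
move=> tM.
have h i j :
    (if M i j != 0 then if M i j < 0 then -1 else 1 else 0 : int) = M i j.
    by have := tM i j; rewrite !inE => /or3P[] /eqP ->.
by case=> [i|j] [i'|j']; rewrite /signed_adj /edge_sign /= ?h.
Qed.

Lemma bipartite_bigraph : bipartite signed_bigraph.
Proof. by exists (fun x => if x is inl _ then true else false) => -[x|x] [y|y]. Qed.

Lemma bigraph_star_complement (R : realType) (mu : R) (m : nat) :
    mu ^+ 2 = m%:R -> (0 < m)%N -> (0 < #|I|)%N -> #|J| = m.+1 ->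
    ternary M -> rows_orthogonal m M ->
  star_complement (sK1 m.+1) mu signed_bigraph.
Proof.
move=> hm m0 I0 cJ tM oM.
have mu0 : mu != 0 by rewrite -sqrf_eq0 hm pnatr_eq0 -lt0n.
pose S : {set U} := [set x | if x is inl _ then true else false].
have SJ x y : x \notin S -> y \notin S -> ~~ edge signed_bigraph x y.
  by rewrite !inE; case: x; case: y.
have cS : #|~: S| = m.+1.
  rewrite -cJ -(card_imset _ (@inr_inj I J)); apply: eq_card => x.
  rewrite !inE; case: x => x; apply/esym; first by apply/imsetP => -[].
  by apply/imsetP; exists x.
have sub_out (x : {x | x \in ~: S}) : val x \notin S.
  by have := valP x; rewrite inE.
exists S; last first.
  apply/isomorphic_edgeless; split=> [|x y]; last exact: SJ.
  by rewrite card_sig -cS; apply: eq_card.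
apply: star_set_intro => //.
  by have /card_gt0P[i _] := I0; apply/set0Pn; exists (inl i); rewrite inE.
case=> [i|j] [i'|j']; rewrite !inE // => _ _.
rewrite (signed_adj_nedge (x := inl i) (y := inl i')) // mulr0 add0r hm.
rewrite big_mkcond big_sumType /= big1 ?add0r => [|k _]; last by rewrite inE.
rewrite (eq_bigr (fun j => (M i j * M i' j)%:~R)) => [|j _]; last first.
  by rewrite inE !(signed_adj_bigraph tM) /= -intrM.
rewrite -(rmorph_sum (intmul 1)) /= (oM i i').
rewrite (_ : (inl i == inl i') = (i == i')) //.
by case: (_ == _); rewrite ?mulr1 ?mulr0.
Qed.

End SignedBigraph.

(** * Matrices with orthogonal rows *)

Section OrthogonalRows.
Variables (I J : finType) (w : nat) (M : I -> J -> int).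
Hypotheses (w_gt0 : (0 < w)%N) (oM : rows_orthogonal w M).

Let w0 : (w%:R : rat) != 0. Proof. by rewrite pnatr_eq0 -lt0n. Qed.

Lemma rows_orthogonal_card : (#|I| <= #|J|)%N.
Proof.
pose A : 'M[rat]_(#|I|, #|J|) := \matrix_(i, j) (M (enum_val i) (enum_val j))%:~R.
suff /mulmx1_min : A *m (w%:R^-1 *: A^T) = 1%:M by [].
rewrite -scalemxAr; apply/matrixP => i j; rewrite !mxE.
transitivity (w%:R^-1 * (\sum_k M (enum_val i) k * M (enum_val j) k)%:~R : rat).
  congr (_ * _); rewrite rmorph_sum /= -[RHS]sum_enum_val.
  by apply: eq_bigr => k _; rewrite !mxE intrM.
rewrite oM (inj_eq enum_val_inj).
by case: (i == j); rewrite /= ?mulr1n ?mulr0n ?mulr0 ?mulVf.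
Qed.

Lemma columns_orthogonal : #|I| = #|J| -> rows_orthogonal w (fun j i => M i j).
Proof.
move=> eqIJ; pose e (j : 'I_#|I|) : J := enum_val (cast_ord eqIJ j).
have e_bij : bijective e.
  exists (fun j => cast_ord (esym eqIJ) (enum_rank j)) => j.
    by rewrite enum_valK cast_ordK.
  by rewrite /e cast_ordKV enum_rankK.
pose A : 'M[rat]_#|I| := \matrix_(i, j) (M (enum_val i) (e j))%:~R.
have AA : A *m (w%:R^-1 *: A^T) = 1%:M.
  rewrite -scalemxAr; apply/matrixP => i j; rewrite !mxE.
  transitivity (w%:R^-1 * (\sum_k M (enum_val i) k * M (enum_val j) k)%:~R : rat).
    congr (_ * _); rewrite rmorph_sum /= [RHS](reindex e); last exact: onW_bij.
    by apply: eq_bigr => k _; rewrite !mxE intrM.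
  rewrite oM (inj_eq enum_val_inj).
  by case: (i == j); rewrite /= ?mulr1n ?mulr0n ?mulr0 ?mulVf.
move=> j j'; have [e' _ e'K] := e_bij.
have /matrixP/(_ (e' j) (e' j')) := mulmx1C AA.
rewrite -scalemxAl !mxE => h; apply: (@intr_inj rat).
rewrite rmorph_sum -[LHS](mulVKf w0) /= -[X in _ * (_ * X)]sum_enum_val.
transitivity (w%:R * (e' j == e' j')%:R : rat).
  rewrite -h; congr (_ * (_ * _)); apply: eq_bigr => k _.
  by rewrite !mxE !e'K intrM.
rewrite (inj_eq (can_inj e'K)).
by case: (j == j'); rewrite /= ?mulr1 ?mulr0.
Qed.

End OrthogonalRows.

Lemma card_set_natb (T : finType) (P : pred T) :
  #|[set x | P x]| = (\sum_x P x)%N.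
Proof.
rewrite -sum1_card big_mkcond; apply: eq_bigr => x _.
by rewrite inE; case: (P x).
Qed.

Section TernaryRows.
Variables (I J : finType) (m : nat) (M : I -> J -> int).
Hypotheses (cJ : #|J| = m.+1) (tM : ternary M) (oM : rows_orthogonal m M).

Lemma ternary_sq i j : M i j ^+ 2 = (M i j != 0)%:R.
Proof. by have := tM i j; rewrite !inE => /or3P[] /eqP ->. Qed.

(** Each row has exactly one zero, since it has m + 1 entries and squared norm
    m. *)
Lemma ternary_missing i : exists p, forall j, (M i j != 0) = (j != p).
Proof.
have h : (#|[set j | M i j != 0]| = m)%N.
  apply/eqP; rewrite card_set_natb -eqz_nat -natz natr_sum.
  have := oM i i; rewrite eqxx mulr1n => <-; apply/eqP/eq_bigr => j _.
  by rewrite -expr2 ternary_sq.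
have /eqP/cards1P[p hp] : #|~: [set j | M i j != 0]| = 1%N.
  by have := cardsC [set j | M i j != 0]; rewrite cJ h; lia.
exists p => j; have := congr1 (fun A : {set J} => j \in A) hp.
by rewrite !inE => <-; rewrite negbK.
Qed.

(** The inner product of the rows, which is 0, has the parity of the number of
    columns where both are nonzero: m if p = p', and m - 1 otherwise. *)
Lemma ternary_missing_parity i i' p p' : i != i' ->
    (forall j, (M i j != 0) = (j != p)) ->
    (forall j, (M i' j != 0) = (j != p')) ->
  (p == p') = ~~ odd m.
Proof.
move=> ii' hp hp'.
have := oM i i'; rewrite (negPf ii') mulr0n.
rewrite (eq_bigr (fun j => (j \notin [set p; p'])%:R
                            - 2 * (M i j * M i' j == -1)%:R))
  => [|j _]; last first.
  rewrite !inE negb_or -hp -hp'; have := tM i j; have := tM i' j.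
  by rewrite !inE => /or3P[] /eqP -> /or3P[] /eqP ->.
rewrite big_split /= sumrN -mulr_sumr -!natr_sum !natz.
have -> : (\sum_j (j \notin [set p; p']) = m.+1 - (p != p').+1)%N.
  rewrite -card_set_natb -cJ -(cardsC [set p; p']) cards2 addKn.
  by apply: eq_card => j; rewrite !inE.
move: (\sum_j _)%N => k.
have : (p != p' -> 0 < m)%N.
  by move=> pp'; have := max_card [set p; p']; rewrite cards2 pp' cJ.
by case: (p == p') => /=; lia.
Qed.

(** With x, y, z the three rows, sum (x + y) (x + z) = sum x ^ 2 = m, and each
    term of the left-hand side is 0 or 4. *)
Lemma ternary_three_rows i1 i2 i3 p : i1 != i2 -> i1 != i3 -> i2 != i3 ->
    (forall j, (M i1 j != 0) = (j != p)) ->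
    (forall j, (M i2 j != 0) = (j != p)) ->
    (forall j, (M i3 j != 0) = (j != p)) ->
  (4 %| m)%N.
Proof.
move=> n12 n13 n23 h1 h2 h3.
have : \sum_j (M i1 j + M i2 j) * (M i1 j + M i3 j) = m%:Z.
  transitivity (\sum_j (M i1 j * M i1 j + M i1 j * M i3 j + M i1 j * M i2 j
                        + M i2 j * M i3 j)).
    by apply: eq_bigr => j _; ring.
  rewrite !big_split /= !oM eqxx (negPf n12) (negPf n13) (negPf n23).
  by rewrite mulr1n mulr0n !addr0.
rewrite (eq_bigr (fun j =>
    4 * [&& M i1 j == M i2 j, M i1 j == M i3 j & j != p]%:R))
  => [|j _]; last first.
  have := h1 j; have := h2 j; have := h3 j.
  have := tM i1 j; have := tM i2 j; have := tM i3 j.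
  rewrite !inE => /or3P[] /eqP -> /or3P[] /eqP -> /or3P[] /eqP ->;
    by case: (j != p).
rewrite -mulr_sumr -natr_sum natz; move: (\sum_j _)%N => k hk.
by apply/dvdnP; exists k; apply/eqP; rewrite -eqz_nat PoszM mulrC -hk natz.
Qed.

End TernaryRows.

(** * Strongly regular graphs whose adjacency matrix squares to a scalar *)

Lemma w2_signed_adj (T : finType) (G : sgraph T) u v :
  w2 G u v = \sum_x signed_adj G u x * signed_adj G x v.
Proof.
rewrite /w2 /walks2 !card_set_natb -2!natz !natr_sum -sumrB.
apply: eq_bigr => x _; rewrite /signed_adj /edge_sign.
by case: (edge G u x); case: (edge G x v); case: (neg G u x); case: (neg G x v).
Qed.

Lemma srg_of_square (T : finType) (G : sgraph T) (m : nat) :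
    (1 < m)%N -> (0 < #|T|)%N -> bipartite G ->
    (forall u v,
      \sum_x signed_adj G u x * signed_adj G x v = m%:Z *+ (u == v)) ->
  srg G #|T| m 0 0 0.
Proof.
move=> m1 /card_gt0P[u0 _] [c hc] hA.
have deg u : #|[set v | edge G u v]| = m.
  apply/eqP; rewrite card_set_natb -eqz_nat -natz natr_sum.
  have := hA u u; rewrite eqxx mulr1n => <-; apply/eqP/eq_bigr => v _.
  by rewrite (signed_adj_sym _ v) -expr2 signed_adj_sq.
have w20 u v : u != v -> w2 G u v = 0.
  by move=> uv; rewrite w2_signed_adj hA (negPf uv).
split=> //; last first.
  split=> [u v e _|u v e|u v uv _]; apply: w20 => //.
    by apply: contraTneq e => ->; rewrite edge_irr.
  by apply: contraTneq (neg_sub e) => ->; rewrite edge_irr.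
have /card_gt1P[v [v' [ev ev' vv']]] : (1 < #|[set v | edge G u0 v]|)%N.
  by rewrite deg.
rewrite !inE in ev ev'.
split=> [[complete _]|h]; last by have := h u0 v; rewrite ev.
have := hc _ _ (complete _ _ vv'); have := hc _ _ ev; have := hc _ _ ev'.
by case: (c u0); case: (c v); case: (c v').
Qed.

Lemma srg_square_bigraph (I J : finType) (m : nat) (M : I -> J -> int) :
    (1 < m)%N -> (0 < #|I|)%N -> #|I| = #|J| ->
    ternary M -> rows_orthogonal m M ->
  srg (signed_bigraph M) (2 * #|I|) m 0 0 0.
Proof.
move=> m1 I0 IJ tM oM.
have cM := columns_orthogonal (ltnW m1) oM IJ.
have -> : (2 * #|I| = #|{: I + J}|)%N by rewrite card_sum -IJ; lia.
apply: srg_of_square => //; first by rewrite card_sum -IJ; lia.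
  exact: bipartite_bigraph.
move=> u v; under eq_bigr => x _ do rewrite !signed_adj_bigraph //.
rewrite big_sumType /=; case: u v => [i|j] [i'|j'] /=.
- by rewrite big1 ?add0r => [|k _]; [exact: oM | rewrite mul0r].
- by rewrite !big1 // => k _; rewrite ?mul0r ?mulr0.
- by rewrite !big1 // => k _; rewrite ?mul0r ?mulr0.
- by rewrite [X in _ + X]big1 ?addr0 => [|k _]; [exact: cM | rewrite mul0r].
Qed.

(** * Bipartite graphs with an edgeless star complement *)

Lemma bipartite_star_complement_structure (R : realType) (mu : R) (m : nat)
    (T : finType) (G : sgraph T) :
    mu ^+ 2 = m%:R -> (1 < m)%N ->
    bipartite G -> star_complement (sK1 m.+1) mu G ->
  exists (I J : finType) (M : I -> J -> int) (g : I + J -> T),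
    [/\ (0 < #|I|)%N, #|J| = m.+1, ternary M, rows_orthogonal m M &
        bijective g /\ forall x y,
          signed_adj (signed_bigraph M) x y = signed_adj G (g x) (g y)].
Proof.
move=> hm m1 [c hc] [S hS /isomorphic_edgeless[cC discC]].
have mu0 : mu != 0 by rewrite -sqrf_eq0 hm pnatr_eq0 -lt0n ltnW.
have coS x y : x \notin S -> y \notin S -> ~~ edge G x y.
  rewrite -!in_setC => xS yS; exact: (discC (Sub x xS) (Sub y yS)).
have gram x y (xS : x \in S) (yS : y \in S) := star_set_gram mu0 coS hS xS yS.
have cS : #|~: S| = m.+1.
  by rewrite -cC card_sig; apply: eq_card => x; rewrite !inE.
have deg x : x \in S -> #|[set z in ~: S | edge G x z]| = m.
  move=> xS; apply/eqP; rewrite -(eqr_nat R) -hm.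
  have := gram x x xS xS; rewrite eqxx mulr1 signed_adj_nedge ?edge_irr //.
  rewrite mulr0 add0r => ->; rewrite card_set_natb natr_sum [eqbRHS]big_mkcond.
  apply/eqP/eq_bigr => z _; rewrite inE (signed_adj_sym _ z) -intrM -expr2.
  by rewrite signed_adj_sq; case: (z \in S) => //=; case: (edge G x z).
have S_indep x y : x \in S -> y \in S -> ~~ edge G x y.
  move=> xS yS; apply/negP => exy.
  (* Two m-subsets of a set of size m + 1 meet, as m > 1; a common neighbour
     of x and y forces them to have the same colour. *)
  pose N u := [set z in ~: S | edge G u z].
  have [z] : exists z, z \in N x :&: N y.
    apply/set0Pn; rewrite -cards_eq0.
    have := cardsUI (N x) (N y); rewrite !deg // => h.
    have : (#|N x :|: N y| <= m.+1)%N.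
      rewrite -cS subset_leq_card //; apply/subsetP => z; rewrite !inE.
      by case: (z \in S).
    by lia.
  rewrite !inE => /andP[/andP[_ exz] /andP[_ eyz]].
  have := hc _ _ exy; have := hc _ _ exz; have := hc _ _ eyz.
  by case: (c x); case: (c y); case: (c z).
have tM (x y : T) : signed_adj G x y \in [:: 0; 1; -1].
  by rewrite /signed_adj /edge_sign; case: (edge G x y); case: (neg G x y).
pose M (i : {x | x \in S}) (j : {x | x \in ~: S}) := signed_adj G (val i) (val j).
exists {x | x \in S}, {x | x \in ~: S}, M,
  (fun u => match u with inl i => val i | inr j => val j end).
split=> //; [|by move=> i j; exact: tM| |split].
- have [ev cSE _] := hS; rewrite card_sig cSE lt0n mxrank_eq0; exact: ev.
- move=> i i'; have := gram _ _ (valP i) (valP i').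
  rewrite [X in mu * X%:~R]signed_adj_nedge ?S_indep ?(valP i) ?(valP i') //.
  rewrite mulr0 add0r hm => h; apply: (@intr_inj R); rewrite rmorph_sum /=.
  transitivity (m%:R * (val i == val i')%:R : R); last first.
    by rewrite val_eqE; case: (i == i'); rewrite ?mulr1 ?mulr0.
  rewrite h [RHS](eq_bigl (fun z => z \in ~: S)) => [|z]; last by rewrite inE.
  rewrite [RHS]big_sub; apply: eq_bigr => j _.
  by rewrite intrM /M (signed_adj_sym _ (val j)).
- apply: inj_card_bij => [|].
    case=> [i|j] [i'|j'] => [/val_inj -> //|E|E|/val_inj -> //].
      by have := valP i; have := valP j'; rewrite -E inE => /negPf ->.
    by have := valP i'; have := valP j; rewrite E inE => /negPf ->.
  rewrite card_sum !card_sig -(cardsC S) leq_add //.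
- move=> x y; rewrite signed_adj_bigraph => [|i j]; last exact: tM.
  case: x y => [i|j] [i'|j'] //=.
  + by rewrite signed_adj_nedge // S_indep //; exact: valP.
  + by rewrite signed_adj_sym.
  + have := valP j; have := valP j'; rewrite !inE => j'S jS.
    by rewrite signed_adj_nedge // coS.
Qed.

(** * Optimal numbers of rows *)

(** The matrix h with one more column, indexed by None, that is zero. *)
Definition add_zero_column (K L : finType) (h : K -> L -> int) (k : K)
  (l : option L) : int := if l is Some l' then h k l' else 0.

Lemma rows_orthogonal_add_zero_column (K L : finType) w (h : K -> L -> int) :
  rows_orthogonal w h -> rows_orthogonal w (add_zero_column h).
Proof. by move=> oh i j; rewrite big_option /= mul0r add0r; apply: oh. Qed.

Lemma sqr1_ternary (x : int) : x ^+ 2 = 1 -> x \in [:: 0; 1; -1].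
Proof. by move/eqP; rewrite sqrf_eq1 !inE => ->; rewrite orbT. Qed.

Lemma ternary_add_zero_column (K L : finType) (h : K -> L -> int) :
  (forall k l, h k l ^+ 2 = 1) -> ternary (add_zero_column h).
Proof. by move=> h1 k [l|] //=; apply: sqr1_ternary. Qed.

Lemma ternary_conference (K : finType) eps (U : K -> K -> int) :
  conference eps U -> ternary U.
Proof.
case=> U0 U1 _ _ i j; have [->|ij] := eqVneq i j; first by rewrite U0.
exact/sqr1_ternary/U1.
Qed.

Lemma hadamard_order_even m : (1 < m)%N -> hadamard_order m -> ~~ odd m.
Proof.
move=> m1 [K [h [cK h1 oh]]].
have /card_gt1P[i [i' [_ _ ii']]] : (1 < #|K|)%N by rewrite cK.
have hN k l : (add_zero_column h k l != 0) = (l != None).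
  by case: l => [l|] //=; rewrite -sqrf_eq0 h1.
have cL : #|{: option K}| = m.+1 by rewrite card_option cK.
have := @ternary_missing_parity _ _ _ _ cL (ternary_add_zero_column h1)
  (rows_orthogonal_add_zero_column oh) _ _ _ _ ii' (hN i) (hN i').
by rewrite eqxx => <-.
Qed.

Lemma sum_alternating k : \sum_(j < 2 * k) (-1) ^+ j = 0 :> int.
Proof.
elim: k => [|k IH]; first by rewrite muln0 big_ord0.
rewrite mulnS !big_ord_recr /= IH add0r exprS.
by rewrite mulN1r subrr.
Qed.

(** The two rows agree in m / 2 of the nonzero columns and differ in the others.
    List the latter first, and switch at the columns where row i2 is -1. *)
Lemma half_star_switching (I J T : finType) (G : sgraph T) (m : nat)
    (M : I -> J -> int) (g : I + J -> T) (p : J) (i1 i2 : I) :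
    bijective g ->
    (forall x y,
      signed_adj (signed_bigraph M) x y = signed_adj G (g x) (g y)) ->
    #|I| = 2 -> #|J| = m.+1 -> ternary M -> rows_orthogonal m M -> i1 != i2 ->
    (forall i j, (M i j != 0) = (j != p)) ->
  switching_isomorphic G (disj_union (K2_half_star m) (sK1 1)).
Proof.
move=> bg hg cI cJ tM oM i12 hp.
pose P := [set j | (j != p) && (M i1 j != M i2 j)].
pose Q := [set j | (j != p) && (M i1 j == M i2 j)].
have cPQ : (#|P| + #|Q| = m)%N.
  have cp : #|[set j | j != p]| = m.
    have := cardsC1 p; rewrite cJ /= => <-; apply: eq_card => j.
    by rewrite !inE.
  rewrite -cp !card_set_natb -big_split /=; apply: eq_bigr => j _.
  by case: (j != p); case: (_ == _).
have cPeqQ : #|P| = #|Q|.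
  have := oM i1 i2; rewrite (negPf i12) mulr0n => h.
  apply/eqP; rewrite -eqz_nat eq_sym -subr_eq0 -h !card_set_natb -2!natz.
  rewrite !natr_sum -sumrB; apply/eqP/eq_bigr => j _.
  have := hp i1 j; have := hp i2 j; have := tM i1 j; have := tM i2 j.
  by rewrite !inE => /or3P[] /eqP -> /or3P[] /eqP ->; case: (j != p).
have cP : #|P| = (m %/ 2)%N by lia.
pose L := enum P ++ enum Q.
have sL : size L = m by rewrite size_cat -!cardE.
have LE j : j \in L = (j != p).
  by rewrite mem_cat !mem_enum !inE; case: (j != p); case: (_ == _).
have uL : uniq L.
  rewrite cat_uniq !enum_uniq andbT /=; apply/hasPn => j.
  by rewrite !mem_enum !inE => /andP[-> ->].
have nL (j : 'I_m) : nth p L j != p by rewrite -LE mem_nth ?sL.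
pose h (x : ('I_2 + 'I_m) + 'I_1) : I + J :=
  match x with
  | inl (inl i) => inl (if i == ord0 then i1 else i2)
  | inl (inr j) => inr (nth p L j)
  | inr _ => inr p
  end.
pose d (x : ('I_2 + 'I_m) + 'I_1) : int :=
  if x is inl (inr j) then M i2 (nth p L j) else 1.
have bh : bijective h.
  apply: inj_card_bij; last by rewrite !card_sum !card_ord cI cJ addn1.
  have ordE (i i' : 'I_2) :
      (if i == ord0 then i1 else i2) = (if i' == ord0 then i1 else i2) ->
    i = i'.
    move=> E; apply: val_inj; move: E.
    case: i => [[|[|//]] ?]; case: i' => [[|[|//]] ?] //= E.
      by rewrite E eqxx in i12.
    by rewrite E eqxx in i12.
  move=> [[i|j]|k] [[i'|j']|k'] //=.
  - by case=> /ordE ->.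
  - by case=> /eqP; rewrite nth_uniq ?sL // => /eqP/val_inj ->.
  - by case=> E; have := nL j; rewrite E eqxx.
  - by case=> E; have := nL j'; rewrite -E eqxx.
  - by move=> _; rewrite !ord1.
have Mp i : M i p = 0 by apply/eqP; have := hp i p; rewrite eqxx => /negPn.
have M1 i j : j != p -> M i j ^+ 2 = 1.
  by move=> jp; rewrite (ternary_sq tM) hp jp.
have d2 x : d x ^+ 2 = 1 by case: x => [[i|j]|k] //=; rewrite M1.
have entry (i : 'I_2) (j : 'I_m) :
    (if (i == ord0) && (j < m %/ 2)%N then -1 else 1) =
    M i2 (nth p L j) * M (if i == ord0 then i1 else i2) (nth p L j).
  case: (i == ord0); last by rewrite /= -expr2 M1.
  rewrite /= nth_cat -cardE cP; case: ltnP => jm.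
    have : nth p (enum P) j \in P by rewrite -mem_enum mem_nth // -cardE cP.
    rewrite inE => /andP[z0]; move: (nth _ _ _) z0 => z z0.
    have := hp i1 z; have := hp i2 z; rewrite z0.
    have := tM i1 z; have := tM i2 z.
    by rewrite !inE => /or3P[] /eqP -> /or3P[] /eqP ->.
  have : nth p (enum Q) (j - m %/ 2) \in Q.
    by rewrite -mem_enum mem_nth // -cardE -cPeqQ cP; have := ltn_ord j; lia.
  rewrite inE => /andP[z0]; move: (nth _ _ _) z0 => z z0 /eqP ->.
  by rewrite -expr2 M1.
apply: (@switching_isomorphic_bij _ _ _ _ (g \o h) d) => // [|x y].
  exact: bij_comp.
rewrite -hg signed_adj_bigraph // /signed_adj /edge_sign.
case: x y => [[i|j]|k] [[i'|j']|k'] /=; rewrite ?Mp ?mulr0 ?mul1r ?mulr1 //.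
Qed.

(** * The maximal graph *)

(** B is a maximal graph, identified through g with the bipartite graph of M. *)
Section MaximalBigraph.
Variables (R : realType) (mu : R) (m : nat) (T : finType) (B : sgraph T).
Variables (I J : finType) (M : I -> J -> int) (g : I + J -> T).
Hypotheses (hm : mu ^+ 2 = m%:R) (m1 : (1 < m)%N).
Hypothesis hB : maximal_bipartite (sK1 m.+1) mu B.
Hypotheses (cJ : #|J| = m.+1) (tM : ternary M) (oM : rows_orthogonal m M).
Hypothesis bg : bijective g.
Hypothesis hg : forall x y,
  signed_adj (signed_bigraph M) x y = signed_adj B (g x) (g y).

Let m0 : (0 < m)%N. Proof. exact: ltnW. Qed.

(** By maximality of B, no admissible matrix has more rows than M. *)
Lemma maximal_rows (K L : finType) (N : K -> L -> int) :
    #|L| = m.+1 -> ternary N -> rows_orthogonal m N -> (#|K| <= #|I|)%N.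
Proof.
move=> cL tN oN; case: (posnP #|K|) => [-> //|K0].
have [_ _ /(_ _ (signed_bigraph N) (bipartite_bigraph N))] := hB.
rewrite -(bij_eq_card bg) !card_sum cJ cL leq_add2r; apply.
exact: bigraph_star_complement hm m0 K0 cL tN oN.
Qed.

Lemma maximal_singly_even : (2 %| m)%N -> ~~ (4 %| m)%N ->
  switching_isomorphic B (disj_union (K2_half_star m) (sK1 1)).
Proof.
move=> m2 m4; have m_even : ~~ odd m by rewrite -dvdn2.
(* Two orthogonal sign rows: the constant 1 and the alternating one. *)
pose N (b : bool) (j : 'I_m) : int := if b then (-1) ^+ j else 1.
have N1 b j : N b j ^+ 2 = 1 by case: b; rewrite /= ?sqrr_sign ?expr1n.
have oN : rows_orthogonal m N.
  have alt : \sum_(j < m) (-1) ^+ j = 0 :> int.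
    by have /dvdnP[k ->] := m2; rewrite mulnC sum_alternating.
  have all1 (F : 'I_m -> int) : (forall j, F j = 1) -> \sum_j F j = m.
    move=> F1; rewrite (eq_bigr (fun=> 1)) => [|j _]; last exact: F1.
    by rewrite sumr_const card_ord natz.
  case=> -[] /=; rewrite ?mulr1n ?mulr0n.
  - by apply: all1 => j; rewrite -expr2 sqrr_sign.
  - by under eq_bigr => j _ do rewrite mulr1; exact: alt.
  - by under eq_bigr => j _ do rewrite mul1r; exact: alt.
  - by apply: all1 => j; rewrite mul1r.
have I2 : (2 <= #|I|)%N.
  rewrite -card_bool; apply: maximal_rows (ternary_add_zero_column N1)
    (rows_orthogonal_add_zero_column oN).
  by rewrite card_option card_ord.
have /card_gt1P[i1 [i2 [_ _ i12]]] := I2.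
have [p hp1] := ternary_missing cJ tM oM i1.
have hp i j : (M i j != 0) = (j != p).
  have [->|ii1] := eqVneq i i1; first exact: hp1.
  have [p' hp'] := ternary_missing cJ tM oM i.
  have := ternary_missing_parity cJ tM oM ii1 hp' hp1.
  by rewrite m_even => /eqP <-.
have cI : #|I| = 2.
  apply/eqP; rewrite eqn_leq I2 andbT leqNgt; apply: contra m4.
  case/card_gt2P=> x [y [z [_ [xy yz zx]]]].
  apply: (ternary_three_rows tM oM xy _ yz (hp x) (hp y) (hp z)).
  by rewrite eq_sym.
exact: half_star_switching bg hg cI cJ tM oM i12 hp.
Qed.

Lemma maximal_hadamard : hadamard_order m ->
  exists (W : finType) (F : sgraph W),
    [/\ bipartite F, srg F (2 * m) m 0 0 0
      & switching_isomorphic B (disj_union F (sK1 1))].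
Proof.
move=> Hm; have m_even := hadamard_order_even m1 Hm.
have mI : (m <= #|I|)%N.
  have [K [h [cK h1 oh]]] := Hm.
  rewrite -{1}cK; apply: maximal_rows (ternary_add_zero_column h1)
    (rows_orthogonal_add_zero_column oh).
  by rewrite card_option cK.
have /card_gt0P[i1 _] : (0 < #|I|)%N by apply: leq_trans mI.
have [p hp1] := ternary_missing cJ tM oM i1.
have Mp i : M i p = 0.
  apply/eqP; have [->|ii1] := eqVneq i i1.
    by have := hp1 p; rewrite eqxx => /negPn.
  have [p' hp'] := ternary_missing cJ tM oM i.
  have := ternary_missing_parity cJ tM oM ii1 hp' hp1.
  by rewrite m_even => /eqP <-; have := hp' p'; rewrite eqxx => /negPn.
pose J' : finType := {j : J | j \in predC1 p}.
pose M' (i : I) (j : J') := M i (val j).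
have cJ' : #|J'| = m.
  by rewrite card_sig -[RHS]/(m.+1.-1) -cJ -(cardC1 p); apply: eq_card.
have tM' : ternary M' by move=> i j; exact: tM.
have oM' : rows_orthogonal m M'.
  move=> i i'; rewrite -oM [RHS](bigD1 p) //= Mp mul0r add0r.
  by rewrite -(big_sub (predC1 p) (fun j => M i j * M i' j)).
have cI : #|I| = m.
  apply/eqP; rewrite eqn_leq mI -[X in (_ <= X)%N]cJ'.
  by rewrite (rows_orthogonal_card m0 oM').
exists (I + J')%type, (signed_bigraph M'); split; first exact: bipartite_bigraph.
  by rewrite -{1}cI; apply: srg_square_bigraph => //; rewrite cI.
pose h (x : (I + J') + 'I_1) : I + J :=
  match x with
  | inl (inl i) => inl i
  | inl (inr j) => inr (val j)
  | inr _ => inr p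
  end.
have bh : bijective h.
  apply: inj_card_bij; last by rewrite !card_sum card_ord cJ' cJ; lia.
  move=> [[i|j]|k] [[i'|j']|k'] //=.
  - by case=> ->.
  - by case=> /val_inj ->.
  - by case=> E; have := valP j; rewrite inE /= E eqxx.
  - by case=> E; have := valP j'; rewrite inE /= -E eqxx.
  - by rewrite !ord1.
apply: (@switching_isomorphic_bij _ _ _ _ (g \o h) (fun=> 1)) => // [|x y].
  exact: bij_comp.
rewrite !mul1r -hg (signed_adj_bigraph tM).
case: x y => [x|k] [y|k'] /=.
- have -> : signed_adj (disj_union (signed_bigraph M') (sK1 1)) (inl x) (inl y)
     = signed_adj (signed_bigraph M') x y by [].
  by rewrite (signed_adj_bigraph tM'); case: x y => [i|j] [i'|j'].
- by case: x => [i|j]; rewrite /= ?Mp.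
- by case: y => [i|j]; rewrite /= ?Mp.
- by [].
Qed.

Lemma maximal_conference : NC m ->
  exists (W : finType) (F : sgraph W),
    [/\ bipartite F, srg F (2 * m + 2) m 0 0 0 & switching_isomorphic B F].
Proof.
case=> [mE|[m_odd m_pp]]; first by have := m1; rewrite mE.
have [K [U [cK cU]]] := conference_prime_power m_odd m_pp.
have [_ _ _ oU] := cU; rewrite cK in oU.
have cI : #|I| = m.+1.
  apply/eqP; rewrite eqn_leq -{1}cJ (rows_orthogonal_card m0 oM) -cK.
  exact: maximal_rows cK (ternary_conference cU) oU.
exists (I + J)%type, (signed_bigraph M); split; first exact: bipartite_bigraph.
  have -> : (2 * m + 2 = 2 * #|I|)%N by rewrite cI; lia.
  by apply: srg_square_bigraph; rewrite // cI.
apply: (@switching_isomorphic_bij _ _ _ _ g (fun=> 1)) => // x y.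
by rewrite !mul1r hg.
Qed.

End MaximalBigraph.

Theorem theorem4p5 (R : realType) (mu : R) (m s : nat)
    (T : finType) (B : sgraph T)
    (hm : mu ^+ 2 = m%:R) (hs : s = (m + 1)%N) (hs3 : (3 <= s)%N)
    (hB : maximal_bipartite (sK1 s) mu B) :
  [/\ (2 %| m)%N /\ ~~ (4 %| m)%N ->
        switching_isomorphic B (disj_union (K2_half_star m) (sK1 1)),
      NH m ->
        exists (W : finType) (F : sgraph W),
          [/\ bipartite F, srg F (2 * m) m 0 0 0
            & switching_isomorphic B (disj_union F (sK1 1))]
    & NC m ->
        exists (W : finType) (F : sgraph W),
          [/\ bipartite F, srg F (2 * m + 2) m 0 0 0
            & switching_isomorphic B F]].
Proof.
have m1 : (1 < m)%N by lia.
rewrite addn1 in hs; subst s.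
have [bB sB _] := hB.
have [I [J [M [g [_ cJ tM oM [bg hg]]]]]] :=
  bipartite_star_complement_structure hm m1 bB sB.
split=> [[m2 m4]|/NH_hadamard_order Hm|Cm].
- exact: maximal_singly_even hm m1 hB cJ tM oM bg hg m2 m4.
- exact: maximal_hadamard hm m1 hB cJ tM oM bg hg Hm.
- exact: maximal_conference hm m1 hB cJ tM oM bg hg Cm.
Qed.
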